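(* Let $K$ be a field of characteristic $0$, let $A,A'$ be unital associative $K$-algebras, let $C$ be a cocommutative $K$-coalgebra and let $\Phi:C\to\mathrm{Hom}_K(A,A')$ be a measuring of algebras. Then the maps $$H_\bullet^{gl(\Phi)}:C\to\mathrm{Hom}_K(H_\bullet(gl(A)),H_\bullet(gl(A'))),\qquad x\mapsto H_\bullet^{gl(\Phi)}(x)$$ determine a measuring of algebras from $H_\bullet(gl(A))$ to $H_\bullet(gl(A'))$. Similarly, the maps $$HL_\bullet^{gl(\Phi)}:C\to\mathrm{Hom}_K(HL_\bullet(gl(A)),HL_\bullet(gl(A'))),\qquad x\mapsto HL_\bullet^{gl(\Phi)}(x)$$ determine a measuring of algebras from $HL_\bullet(gl(A))$ to $HL_\bullet(gl(A'))$.
   Context: Write $\Delta_C(x)=x_{(1)}\otimes x_{(2)}$ (Sweedler, sums suppressed; likewise iterated). A measuring of algebras $\Phi:C\to\mathrm{Hom}_K(A,A')$ is a $K$-linear map with $\Phi(x)(ab)=\Phi(x_{(1)})(a)\Phi(x_{(2)})(b)$ and $\Phi(x)(1_A)=\epsilon_C(x)1_{A'}$. $gl(A)=\varinjlim_r gl_r(A)$ is the Lie algebra of matrices over $A$ under the commutator, also regarded as a Leibniz algebra; $x\in C$ acts on matrices entrywise via $\Phi(x)$, giving $gl(\Phi):C\to \mathrm{Hom}_K(gl(A),gl(A'))$. $H_\bullet(gl(A))$ is the homology of the Chevalley–Eilenberg complex $\wedge^\bullet gl(A)$, with $d(\alpha_1\wedge\cdots\wedge\alpha_n)=\sum_{i<j}(-1)^{i+j+1}[\alpha_i,\alpha_j]\wedge\alpha_1\wedge\cdots\hat\alpha_i\cdots\hat\alpha_j\cdots\wedge\alpha_n$,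 and $HL_\bullet(gl(A))$ is the homology of the Leibniz complex $gl(A)^{\otimes\bullet}$, with $d(\alpha_1,\dots,\alpha_n)=\sum_{i<j}(-1)^j(\alpha_1,\dots,\alpha_{i-1},[\alpha_i,\alpha_j],\dots,\hat\alpha_j,\dots,\alpha_n)$. The maps $H^{gl(\Phi)}_\bullet(x)$ and $HL^{gl(\Phi)}_\bullet(x)$ are induced by $\alpha_1\wedge\cdots\wedge\alpha_n\mapsto x_{(1)}(\alpha_1)\wedge\cdots\wedge x_{(n)}(\alpha_n)$ and $\alpha_1\otimes\cdots\otimes\alpha_n\mapsto x_{(1)}(\alpha_1)\otimes\cdots\otimes x_{(n)}(\alpha_n)$ (in degree $0$: multiplication by $\epsilon_C(x)$). Products: these homologies are also computed by the quotient complexes of coinvariants $(\wedge^ngl(A))_{gl(K)}$ and $(gl(A)^{\otimes n})_{gl(K)}$ (colimits over $r$ of coinvariants for the adjoint action of $gl_r(K)$). Let $\oplus:gl(A)\times gl(A)\to gl(A)$ be the operation of Loday, where $\alpha\oplus\beta$ has $(2k-1,2l-1)$ entry $\alpha_{kl}$, $(2k,2l)$ entry $\beta_{kl}$, and all other entries $0$. The products on $H_\bullet(gl(A))$ and $HL_\bullet(gl(A))$ are induced on coinvariants by $$(\alpha_1\wedge\cdots\wedge\alpha_p)\otimes(\beta_1\wedge\cdots\wedge\beta_q)\mapsto(\alpha_1\oplus0)\wedge\cdots\wedge(\alpha_p\oplus0)\wedge(0\oplus\beta_1)\wedge\cdots\wedge(0\oplus\beta_q)$$ and the same formula with $\wedge$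 replaced by $\otimes$, respectively. *)

(* Defs.v *)
From HB Require Import structures.
From mathcomp Require Import all_boot all_algebra.
From mathcomp Require Import boolp classical_sets functions fsbigop.
From mathcomp.multinomials Require Import freeg.

Set Implicit Arguments.
Unset Strict Implicit.
Unset Printing Implicit Defensive.

Import GRing.Theory.
Local Open Scope classical_set_scope.
Local Open Scope ring_scope.
Local Open Scope quotient_scope.

(* Unital associative K-algebras. Unlike for the library's algType, 1 != 0 is
   not required, so that the zero algebra is included. *)
HB.mixin Record Lmodule_isUnitalAlgebra (K : pzRingType) A
    of GRing.Lmodule K A := {
  amul : A -> A -> A;
  aone : A;
  amulA : associative amul;
  amul1r : left_id aone amul;
  amulr1 : right_id aone amul;
  amul_linearl : forall b, linear (amul^~ b);
  amul_linearr : forall a, linear (amul a)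
}.

#[short(type="unitalAlgType")]
HB.structure Definition UnitalAlgebra (K : pzRingType) :=
  {A of GRing.Lmodule K A & Lmodule_isUnitalAlgebra K A}.

Section Subquotients.
Variables (K : pzRingType) (V : lmodType K).

Definition span (S : set V) : set V :=
  [set v | exists2 s : seq (K * V),
    forall p, p \in s -> S p.2 & v = \sum_(p <- s) p.1 *: p.2].

Definition in_span (S : set V) : {pred V} := fun v => `[< span S v >].

Lemma in_span_submod (S : set V) : submod_closed (in_span S).
Proof.
split; first by apply/asboolP; exists [::] => //; rewrite big_nil.
move=> a u v /asboolP[s sS ->] /asboolP[t tS ->]; apply/asboolP.
exists ([seq (a * p.1, p.2) | p <- s] ++ t).
  by move=> p; rewrite mem_cat => /orP[/mapP[q /sS qS ->]//|/tS].
rewrite big_cat big_map scaler_sumr; congr (_ + _).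
by apply: eq_bigr => p _; rewrite scalerA.
Qed.

HB.instance Definition _ (S : set V) :=
  GRing.isSubmodClosed.Build K V (in_span S) (in_span_submod S).

Lemma in_spanP (S : set V) v : reflect (span S v) (v \in in_span S).
Proof. exact: asboolP. Qed.

Lemma sub_span (S : set V) : S `<=` span S.
Proof.
move=> v Sv; exists [:: (1, v)]; last by rewrite big_seq1 scale1r.
by move=> p; rewrite inE => /eqP ->.
Qed.

Lemma span_id (S : set V) :
  S 0 -> (forall a u v, S u -> S v -> S (a *: u + v)) -> span S = S.
Proof.
move=> S0 SD; apply/seteqP; split; last exact: sub_span.
move=> _ [s sS ->]; elim: s sS => [|p s IHs] sS; first by rewrite big_nil.
rewrite big_cons; apply: SD; first by apply: sS; rewrite inE eqxx.
by apply: IHs => q qs; apply: sS; rewrite inE qs orbT.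
Qed.

Record subspace (S : set V) := Subspace {
  subspace_val : V;
  subspace_valP : subspace_val \in in_span S
}.

HB.instance Definition _ (S : set V) := [isSub for @subspace_val S].
HB.instance Definition _ (S : set V) := [Choice of subspace S by <:].
HB.instance Definition _ (S : set V) :=
  [SubChoice_isSubLmodule of subspace S by <:].

(* V / span S *)
Definition quot (S : set V) : Type := Quotient.quot (in_span S).

HB.instance Definition _ (S : set V) := GRing.Zmodule.on (quot S).

Definition cl (S : set V) (v : V) : quot S := \pi_(Quotient.quot (in_span S)) v.
Definition rep (S : set V) (u : quot S) : V :=
  repr (u : Quotient.quot (in_span S)).

Section QuotTheory.
Variable S : set V.

Lemma repK (u : quot S) : cl S (rep u) = u. Proof. exact: reprK. Qed.

Lemma clP (u v : V) : cl S u = cl S v <-> span S (u - v).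
Proof.
split=> [/eqP|uv]; first by rewrite -Quotient.idealrBE => /asboolP.
by apply/eqP; rewrite -Quotient.idealrBE; apply/asboolP.
Qed.

Lemma clD (u v : V) : cl S (u + v) = cl S u + cl S v.
Proof. by rewrite /cl !piE. Qed.

Definition quot_scale (a : K) (u : quot S) : quot S := cl S (a *: rep u).

Lemma cl_scale a v : cl S (a *: v) = quot_scale a (cl S v).
Proof.
apply/clP; rewrite -scalerBr; apply/in_spanP/rpredZ/in_spanP/clP.
by rewrite repK.
Qed.

Lemma quot_scaleA a b u : quot_scale a (quot_scale b u) = quot_scale (a * b) u.
Proof. by rewrite -[u]repK -!cl_scale scalerA. Qed.
Lemma quot_scale1 : left_id 1 quot_scale.
Proof. by move=> u; rewrite -[u]repK -cl_scale scale1r. Qed.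
Lemma quot_scaleDr : right_distributive quot_scale +%R.
Proof.
by move=> a u v; rewrite -[u]repK -[v]repK -clD -!cl_scale -clD scalerDr.
Qed.
Lemma quot_scaleDl u : {morph quot_scale^~ u : a b / a + b}.
Proof. by move=> a b; rewrite -[u]repK -!cl_scale -clD scalerDl. Qed.

HB.instance Definition _ := GRing.Zmodule_isLmodule.Build K (quot S)
  quot_scaleA quot_scale1 quot_scaleDr quot_scaleDl.

Lemma cl_is_linear : linear (cl S).
Proof. by move=> a u v; rewrite clD cl_scale. Qed.

HB.instance Definition _ :=
  GRing.isLinear.Build K V (quot S) _ (cl S) cl_is_linear.

End QuotTheory.
End Subquotients.

(* The map of quotients induced by f: it is computed on a representative, as in
   the lift_op1 of generic_quotient, and is characterized by quot_mapE. *)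
Definition quot_map (K : pzRingType) (V W : lmodType K) (S : set V) (T : set W)
  (f : V -> W) (u : quot S) : quot T := cl T (f (rep u)).
Arguments quot_map {K V W S T} f u.

Lemma quot_mapE (K : pzRingType) (V W : lmodType K) (S : set V) (T : set W)
    (f : {linear V -> W}) (v : V) :
  (forall s, S s -> span T (f s)) -> quot_map f (cl S v) = cl T (f v).
Proof.
move=> fST; apply/clP; rewrite -linearB /=.
have /clP[s sS ->] : cl S (rep (cl S v)) = cl S v by rewrite repK.
rewrite linear_sum big_seq; apply/in_spanP/rpred_sum => p ps.
by rewrite linearZ rpredZ//; apply/in_spanP/fST/sS.
Qed.

Section Homology.
Variable K : pzRingType.

(* For a linear d the set of cycles is already a submodule, so that taking its
   span changes nothing; same for the boundaries below. *)
Definition cycles (V : lmodType K) (d : V -> V) : Type :=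
  subspace [set v | d v = 0].

HB.instance Definition _ (V : lmodType K) (d : V -> V) :=
  GRing.Lmodule.on (cycles d).
HB.instance Definition _ (V : lmodType K) (d : V -> V) :=
  SubType.on (cycles d).

Definition boundaries (V : lmodType K) (d : V -> V) : set (cycles d) :=
  [set z | exists v, val z = d v].
Arguments boundaries {V} d _.

(* Complexes are represented by their total space V, the direct sum of the
   chain groups in all degrees, with the total differential d; ker d / im d is
   then the direct sum of the homology groups. *)
Definition homology (V : lmodType K) (d : V -> V) : Type :=
  quot (boundaries d).

HB.instance Definition _ (V : lmodType K) (d : V -> V) :=
  GRing.Lmodule.on (homology d).

Definition hclass (V : lmodType K) (d : V -> V) (v : V) : homology d :=
  cl (boundaries d) (insubd 0 v).

Definition hrep (V : lmodType K) (d : V -> V) (h : homology d) : V :=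
  val (rep h).

Definition homology_map (V W : lmodType K) (d : V -> V) (d' : W -> W)
  (f : V -> W) (h : homology d) : homology d' := hclass d' (f (hrep h)).

End Homology.

Section Words.
Variable K : fieldType.

(* The free vector space on the words with letters in V. *)
Definition words (V : lmodType K) : Type := {freeg (seq V) / K}.
HB.instance Definition _ (V : lmodType K) := GRing.Lmodule.on (words V).

Definition word (V : lmodType K) (s : seq V) : words V := << s >>.

Definition multilinear_rel (V : lmodType K) : set (words V) :=
  [set w | exists s1 s2 (a : K) (x y : V),
     w = word (s1 ++ (a *: x + y) :: s2)
         - a *: word (s1 ++ x :: s2) - word (s1 ++ y :: s2)].
Arguments multilinear_rel : clear implicits.

Definition alternating_rel (V : lmodType K) : set (words V) :=
  [set w | exists2 s : seq V, ~~ uniq s & w = word s].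
Arguments alternating_rel : clear implicits.

(* The quotient of words V by tensor_rel is the tensor algebra of V, i.e. the
   direct sum of the tensor powers of V; the quotient by exterior_rel is the
   exterior algebra of V. *)
Definition tensor_rel (V : lmodType K) : set (words V) := multilinear_rel V.
Definition exterior_rel (V : lmodType K) : set (words V) :=
  multilinear_rel V `|` alternating_rel V.

Definition bilinear_rel (V W : lmodType K) : set {freeg (V * W) / K} :=
  [set w | exists (a : K) (x y : V) (z : W),
     w = << (a *: x + y, z) >> - a *: << (x, z) >> - << (y, z) >>] `|`
  [set w | exists (a : K) (x : V) (y z : W),
     w = << (x, a *: y + z) >> - a *: << (x, y) >> - << (x, z) >>].
Arguments bilinear_rel : clear implicits.

Definition tensor (V W : lmodType K) : Type := quot (bilinear_rel V W).
HB.instance Definition _ (V W : lmodType K) := GRing.Lmodule.on (tensor V W).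

Definition pure (V W : lmodType K) (x : V) (y : W) : tensor V W :=
  cl (bilinear_rel V W) << (x, y) >>.

(* tensor_lift f (\sum_i x_i (x) y_i) = \sum_i f x_i y_i for bilinear f. *)
Definition tensor_lift (V W U : lmodType K) (f : V -> W -> U)
    (t : tensor V W) : U :=
  fglift (fun p : V * W => f p.1 p.2) (rep t).

End Words.
Arguments word {K V} s.
Arguments tensor_rel {K} V _.
Arguments exterior_rel {K} V _.

Section Coalgebras.
Variables (K : fieldType) (C : lmodType K).
Variables (Delta : {linear C -> tensor C C}) (eps : {linear C -> K^o}).

(* \sum f x_(1) x_(2) *)
Definition sweedler (U : lmodType K) (f : C -> C -> U) (x : C) : U :=
  tensor_lift f (Delta x).

Record is_coalgebra : Prop := IsCoalgebra {
  coassociative : forall x : C,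
    sweedler (fun y z => sweedler (fun u v => pure u (pure v z)) y) x =
    sweedler (fun y z => sweedler (fun u v => pure y (pure u v)) z) x;
  counit_l : forall x : C, sweedler (fun y z => eps y *: z) x = x;
  counit_r : forall x : C, sweedler (fun y z => eps z *: y) x = x
}.

Definition cocommutative : Prop :=
  forall x : C, sweedler (fun y z => pure z y) x = Delta x.

(* The words \sum x_(1) ... x_(n), which modulo tensor_rel depend only on x; the
   case n = 0 is eps x times the empty word. *)
Fixpoint iter_Delta (n : nat) (x : C) : words C :=
  if n is m.+1 then
    sweedler (fun y z => fglift (fun s => word (y :: s)) (iter_Delta m z)) x
  else eps x *: word [::].

Record measuring (A A' : lmodType K) (mulA : A -> A -> A) (oneA : A)
    (mulA' : A' -> A' -> A') (oneA' : A') (Phi : C -> A -> A') : Prop :=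
  Measuring {
    measuring_linear : forall x, linear (Phi x);
    measuring_linearC : forall a, linear (Phi^~ a);
    measuring_mul : forall x a b,
      Phi x (mulA a b) = sweedler (fun y z => mulA' (Phi y a) (Phi z b)) x;
    measuring_one : forall x, Phi x oneA = eps x *: oneA'
  }.

End Coalgebras.
Arguments cocommutative {K C} Delta.

Section Matrices.
Variable K : fieldType.

Section GlModule.
Variable V : lmodType K.

Definition bounded_mx : {pred nat -> nat -> V} := fun a =>
  `[< exists r : nat, forall i j, (r <= i)%N || (r <= j)%N -> a i j = 0 >].

Lemma bounded_mx_submod : submod_closed bounded_mx.
Proof.
split; first by apply/asboolP; exists 0%N.
move=> c a b /asboolP[r ar] /asboolP[s bs]; apply/asboolP.
exists (maxn r s) => i j; rewrite !geq_max => rsij.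
have -> : (c *: a + b) i j = c *: a i j + b i j by [].
by case/orP: rsij => /andP[rij sij];
  rewrite ar ?bs ?rij ?sij ?orbT// scaler0 addr0.
Qed.

HB.instance Definition _ :=
  GRing.isSubmodClosed.Build K (nat -> nat -> V) bounded_mx bounded_mx_submod.

(* The colimit of the spaces of r x r matrices along the inclusions as upper
   left blocks. *)
Record gl := Gl {
  gl_mx :> nat -> nat -> V;
  gl_mxP : gl_mx \in bounded_mx
}.

HB.instance Definition _ := [isSub for gl_mx].
HB.instance Definition _ := [Choice of gl by <:].
HB.instance Definition _ := [SubChoice_isSubLmodule of gl by <:].

Lemma gl_bounded (a : gl) :
  exists r : nat, forall i j, (r <= i)%N || (r <= j)%N -> a i j = 0.
Proof. by apply/asboolP; case: a. Qed.

End GlModule.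

Lemma gl_map_subproof (V W : lmodType K) (f : {linear V -> W}) (a : gl V) :
  (fun i j => f (a i j)) \in @bounded_mx W.
Proof.
have [r ar] := gl_bounded a; apply/asboolP; exists r => i j /ar ->.
exact: linear0.
Qed.

Definition gl_map (V W : lmodType K) (f : {linear V -> W}) (a : gl V) : gl W :=
  Gl (gl_map_subproof f a).

Lemma oplus_subproof (V : lmodType K) (a b : gl V) :
  (fun i j => if odd i != odd j then 0
              else if odd i then b i./2 j./2 else a i./2 j./2)
    \in @bounded_mx V.
Proof.
have [[r ar] [s bs]] := (gl_bounded a, gl_bounded b); apply/asboolP.
exists (maxn r s).*2 => i j rsij; case: ifP => // _.
have {}rsij : (maxn r s <= i./2)%N || (maxn r s <= j./2)%N.
  by case/orP: rsij => /half_leq; rewrite doubleK => ->; rewrite ?orbT.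
move: rsij; rewrite !geq_max => rsij.
by case: ifP => _; [apply: bs | apply: ar];
  case/orP: rsij => /andP[rij sij]; rewrite ?rij ?sij ?orbT.
Qed.

(* Rows and columns are numbered from 0, hence the first argument occupies the
   even positions. *)
Definition oplus (V : lmodType K) (a b : gl V) : gl V :=
  Gl (oplus_subproof a b).

Lemma amul0r (A : unitalAlgType K) (b : A) : amul 0 b = 0.
Proof.
by have := amul_linearl b (-1) 0 0; rewrite scaler0 addr0 scaleN1r addNr.
Qed.

Lemma amulr0 (A : unitalAlgType K) (a : A) : amul a 0 = 0.
Proof.
by have := amul_linearr a (-1) 0 0; rewrite scaler0 addr0 scaleN1r addNr.
Qed.

Lemma gl_mul_subproof (A : unitalAlgType K) (a b : gl A) :
  (fun i j => \sum_(k \in [set: nat]) amul (a i k) (b k j)) \in @bounded_mx A.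
Proof.
have [[r ar] [s bs]] := (gl_bounded a, gl_bounded b); apply/asboolP.
exists (maxn r s) => i j rsij; apply: fsbig1 => k _.
case/orP: rsij; rewrite geq_max => /andP[rij sij].
  by rewrite ar ?rij ?amul0r.
by rewrite bs ?sij ?orbT ?amulr0.
Qed.

Definition gl_mul (A : unitalAlgType K) (a b : gl A) : gl A :=
  Gl (gl_mul_subproof a b).

Definition lie (A : unitalAlgType K) (a b : gl A) : gl A := gl_mul a b - gl_mul b a.

Definition alg_scalar (A : unitalAlgType K) (k : K^o) : A := k *: aone.

Lemma alg_scalar_is_linear (A : unitalAlgType K) : linear (@alg_scalar A).
Proof. by move=> a k l; rewrite /alg_scalar scalerDl -scalerA. Qed.

HB.instance Definition _ (A : unitalAlgType K) :=
  GRing.isLinear.Build K K^o A _ (@alg_scalar A) (@alg_scalar_is_linear A).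

Definition gl_scalar (A : unitalAlgType K) (g : gl K^o) : gl A :=
  gl_map (@alg_scalar A) g.

End Matrices.

Section Differentials.
Variables (K : fieldType) (A : unitalAlgType K).
Implicit Types s : seq (gl A).

Definition del (i : nat) s : seq (gl A) := take i s ++ drop i.+1 s.

Definition d_CE : words (gl A) -> words (gl A) :=
  fglift (fun s => \sum_(j < size s) \sum_(i < j)
    (-1) ^+ (i + j).+1 *: word (lie s`_i s`_j :: del i (del j s))).

(* Letters are numbered from 0, hence the sign. *)
Definition d_Leibniz : words (gl A) -> words (gl A) :=
  fglift (fun s => \sum_(j < size s) \sum_(i < j)
    (-1) ^+ j.+1 *: word (del j (set_nth 0 s i (lie s`_i s`_j)))).

Definition adjoint (g : gl A) : words (gl A) -> words (gl A) :=
  fglift (fun s => \sum_(i < size s) word (set_nth 0 s i (lie g s`_i))).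

Definition oplus_words (u v : words (gl A)) : words (gl A) :=
  fglift (fun s => fglift (fun t =>
    word ([seq oplus a 0 | a <- s] ++ [seq oplus 0 b | b <- t])) v) u.

End Differentials.

(* The constructions common to the two homology theories, for the complexes
   obtained from the words in gl A by imposing the relations rel: the
   Chevalley-Eilenberg complex for exterior_rel and d_CE, the Leibniz complex
   for tensor_rel and d_Leibniz. *)
Section HomologyOfGl.
Variable K : fieldType.
Variable rel : forall V : lmodType K, set (words V).
Variable dw : forall A : unitalAlgType K, words (gl A) -> words (gl A).

Section Algebra.
Variable A : unitalAlgType K.

Definition chains : Type := quot (@rel (gl A)).
HB.instance Definition _ := GRing.Lmodule.on chains.

Definition chains_d : chains -> chains := quot_map (@dw A).

Definition adjoint_rel : set chains :=
  [set u | exists (g : gl K^o) (c : chains),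
     u = quot_map (adjoint (gl_scalar A g)) c].
Arguments adjoint_rel : clear implicits.

(* Coinvariants commute with colimits: as gl A is the colimit of the gl_r(A),
   this is the colimit over r of the coinvariants under gl_r(K). *)
Definition coinvariants : Type := quot adjoint_rel.
HB.instance Definition _ := GRing.Lmodule.on coinvariants.

Definition coinvariants_d : coinvariants -> coinvariants := quot_map chains_d.

Definition Hgl : Type := homology chains_d.
HB.instance Definition _ := GRing.Lmodule.on Hgl.

Definition Hcoinv : Type := homology coinvariants_d.
HB.instance Definition _ := GRing.Lmodule.on Hcoinv.

(* The map induced by the projection of chains onto coinvariants. It is an
   isomorphism in characteristic 0. *)
Definition to_coinv : Hgl -> Hcoinv :=
  homology_map coinvariants_d (cl adjoint_rel).

Definition coinv_mul (u v : coinvariants) : coinvariants :=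
  cl adjoint_rel (cl (@rel (gl A)) (oplus_words (rep (rep u)) (rep (rep v)))).

Definition Hcoinv_mul (x y : Hcoinv) : Hcoinv :=
  hclass coinvariants_d (coinv_mul (hrep x) (hrep y)).

(* The product of Hcoinv transported along the isomorphism to_coinv. *)
Definition Hgl_mul (x y : Hgl) : Hgl :=
  xget 0 [set z | to_coinv z = Hcoinv_mul (to_coinv x) (to_coinv y)].

Definition Hgl_one : Hgl := hclass chains_d (cl (@rel (gl A)) (word [::])).

End Algebra.

Section Action.
Variables (C : lmodType K).
Variables (Delta : {linear C -> tensor C C}) (eps : {linear C -> K^o}).
Variables (A A' : unitalAlgType K) (Phi : C -> {linear A -> A'}).

(* zip (x_(1) ... x_(n)) (alpha_1 ... alpha_n) is mapped letter by letter. *)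
Definition words_action (x : C) : words (gl A) -> words (gl A') :=
  fglift (fun s => fglift (fun xs =>
    word [seq gl_map (Phi p.1) p.2 | p <- zip xs s])
      (iter_Delta Delta eps (size s) x)).

Definition Hgl_action (x : C) : Hgl A -> Hgl A' :=
  homology_map (@chains_d A') (quot_map (words_action x)).

End Action.
End HomologyOfGl.

Section Theories.
Variables (K : fieldType).

Definition H_gl (A : unitalAlgType K) : Type := Hgl (@exterior_rel K) (@d_CE K) A.
HB.instance Definition _ (A : unitalAlgType K) := GRing.Lmodule.on (H_gl A).
Definition H_mul (A : unitalAlgType K) : H_gl A -> H_gl A -> H_gl A :=
  @Hgl_mul K (@exterior_rel K) (@d_CE K) A.
Definition H_one (A : unitalAlgType K) : H_gl A :=
  @Hgl_one K (@exterior_rel K) (@d_CE K) A.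

Definition HL_gl (A : unitalAlgType K) : Type := Hgl (@tensor_rel K) (@d_Leibniz K) A.
HB.instance Definition _ (A : unitalAlgType K) := GRing.Lmodule.on (HL_gl A).
Definition HL_mul (A : unitalAlgType K) : HL_gl A -> HL_gl A -> HL_gl A :=
  @Hgl_mul K (@tensor_rel K) (@d_Leibniz K) A.
Definition HL_one (A : unitalAlgType K) : HL_gl A :=
  @Hgl_one K (@tensor_rel K) (@d_Leibniz K) A.

Variables (C : lmodType K).
Variables (Delta : {linear C -> tensor C C}) (eps : {linear C -> K^o}).
Variables (A A' : unitalAlgType K) (Phi : C -> {linear A -> A'}).

Definition H_map (x : C) : H_gl A -> H_gl A' :=
  @Hgl_action K (@exterior_rel K) (@d_CE K) C Delta eps A A' Phi x.

Definition HL_map (x : C) : HL_gl A -> HL_gl A' :=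
  @Hgl_action K (@tensor_rel K) (@d_Leibniz K) C Delta eps A A' Phi x.

End Theories.
Arguments H_mul {K} A.
Arguments H_one {K} A.
Arguments HL_mul {K} A.
Arguments HL_one {K} A.

(* Main.v *)
Require Import Defs.
From mathcomp Require Import all_boot all_algebra.
From HB Require Import structures.
From mathcomp Require Import boolp classical_sets functions fsbigop.
From mathcomp.multinomials Require Import freeg.
Import Defs.

Set Implicit Arguments.
Unset Strict Implicit.
Unset Printing Implicit Defensive.

Import GRing.Theory.
Local Open Scope ring_scope.

(** Both complexes are algebras: the tensor algebra (ext = false) and the exterior
    algebra (ext = true) of gl A, with concatenation of words as product. In both
    the differential satisfies

      d (u g) = (d u) g + ad_g (sgn u)     for a letter g in gl A,

    where sgn is the parity involution, because the Chevalley-Eilenberg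
    differential is the image of the Leibniz one (d_CE_Leibniz). This recursion
    determines d, so that the two assertions have one proof, uniform in ext.

    The coalgebra C acts on words by x (u v) = sum of x_(1)(u) x_(2)(v) (actM).
    As C is cocommutative, x [a, b] = sum of [x_(1) a, x_(2) b] on matrices, and
    an induction on words shows that x commutes with d (act_wd). The formula for
    the product, the concatenation of all the alpha + 0 with all the 0 + beta
    (+ standing for the operation of Loday), already makes sense for chains, where
    it is called wplus. As alpha + 0 and 0 + beta commute, d is a derivation
    for it up to sgn (wd_wplus), hence it induces a product on homology, and
    x (wplus u v) = sum of wplus (x_(1) u) (x_(2) v) is immediate (act_wplus).

    It remains to see that this is the product in question, which is defined on the
    coinvariants and transported along to_coinv. The projection onto coinvariants
    carries one product to the other, so all that is needed is the injectivity of
    to_coinv: a cycle in the span of the ad_g c, with g in gl K, is a boundary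
    (span_ad_boundary). Here characteristic 0 is essential. By Cartan's homotopy
    (wd_homotopy) the operators ad_g map cycles to boundaries, and so does the
    Casimir operator, the sum of the ad_(e_ij) ad_(e_ji) over i, j < r. On words in
    multiples of matrix units, with fixed coefficients from A, ad_(e_ij) is given by
    an integral matrix, the transpose of that of ad_(e_ji). So the Casimir operator
    is a sum of Gram matrices over the integers, and by positivity some polynomial q
    with q(0) != 0 satisfies q(Casimir) = 0 on the image of every ad_(e_ij)
    (gram_annihilator). If u is a cycle in the span of these images, then
    0 = q(Casimir) u = q(0) u + a boundary, and q(0) is invertible in K. This
    elementary argument takes the place of the complete reducibility of the tensor
    representations of gl_r(K). *)

(** * Linear maps out of free modules, quotients and tensor products *)

Section FreeModules.
Variables (K : nzRingType) (T : choiceType) (U : lmodType K).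
Implicit Types (f : T -> U) (D : {freeg T / K}).

Lemma fglift_sum_terms f (c : T -> K) (r : seq T) :
  fglift f (\sum_(z <- r) << c z *g z >>) = \sum_(z <- r) c z *: f z.
Proof.
have addf : additive (fglift f) by exact: lift_is_additive.
elim: r => [|z r IHr].
  by rewrite !big_nil; have := addf 0 0; rewrite subr0 subrr.
rewrite !big_cons; have := addf << c z *g z >> (- \sum_(z <- r) << c z *g z >>).
rewrite opprK => ->; rewrite liftU -IHr; congr (_ + _).
have f0 : fglift f 0 = 0 by have := addf 0 0; rewrite subr0 subrr.
have := addf 0 (\sum_(z <- r) << c z *g z >>).
by rewrite add0r f0 add0r => ->; rewrite opprK.
Qed.

Lemma fglift_sum f D : fglift f D = \sum_(z <- dom D) coeff z D *: f z.
Proof. by rewrite -{1}[D]freeg_sumE fglift_sum_terms. Qed.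

Lemma fglift_is_linear f : linear (fglift f).
Proof.
have addf : additive (fglift f) by exact: lift_is_additive.
have f0 : fglift f 0 = 0 by have := addf 0 0; rewrite subr0 subrr.
have fN v : fglift f (- v) = - fglift f v.
  by have := addf 0 v; rewrite f0 !add0r.
move=> a u v; rewrite -[v in LHS]opprK addf fN opprK; congr (_ + _).
have -> : a *: u = \sum_(z <- dom u) << a * coeff z u *g z >> by [].
rewrite fglift_sum_terms fglift_sum scaler_sumr.
by apply: eq_bigr => z _; rewrite scalerA.
Qed.

HB.instance Definition _ f :=
  GRing.isLinear.Build K {freeg T / K} U _ (fglift f) (fglift_is_linear f).

Lemma fglift1 f x : fglift f << x >> = f x.
Proof. by rewrite liftU scale1r. Qed.

Lemma freeg_ind (P : {freeg T / K} -> Prop) :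
    P 0 -> (forall x, P << x >>) ->
    (forall a u v, P u -> P v -> P (a *: u + v)) -> forall u, P u.
Proof.
move=> P0 P1 PD u; rewrite -[u]freeg_sumE.
elim: (dom u) => [|z s IHs]; first by rewrite big_nil.
rewrite big_cons; have -> : << coeff z u *g z >> = coeff z u *: << z >>.
  by apply/eqP/freeg_eqP => x; rewrite coeffZ !coeffU mulrA mulr1.
exact: PD.
Qed.

End FreeModules.

Section FreeModuleMaps.
Variables (K : nzRingType) (T : choiceType) (U : lmodType K).
Implicit Types (f g : T -> U) (D : {freeg T / K}).

Lemma fglift_linear_comp (W : lmodType K) f (g : {linear U -> W}) h D :
  (forall x, g (f x) = h x) -> g (fglift f D) = fglift h D.
Proof.
by move=> gfh; elim/freeg_ind: D => [|x|a u v IHu IHv];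
  rewrite ?linear0 ?fglift1 ?linear0 ?fglift1// !linearP /= IHu IHv.
Qed.

Lemma eq_fglift f g D : f =1 g -> fglift f D = fglift g D.
Proof. by move=> /funext ->. Qed.

End FreeModuleMaps.

Lemma fglift_lincomb (K : fieldType) (T : choiceType) (U : lmodType K)
    (f g : T -> U) a (D : {freeg T / K}) :
  fglift (fun x => a *: f x + g x) D = a *: fglift f D + fglift g D.
Proof.
elim/freeg_ind: D => [|x|b u v IHu IHv].
- by rewrite !linear0 addr0.
- by rewrite !fglift1.
by rewrite !linearP /= IHu IHv !scalerDr !scalerA (mulrC b) addrACA.
Qed.

Section Quotients.
Variables (K : fieldType) (V : lmodType K) (S : set V).

Lemma span_kernel (U : lmodType K) (f : {linear V -> U}) v :
  (forall s, S s -> f s = 0) -> span S v -> f v = 0.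
Proof.
move=> fS [s sS ->]; rewrite linear_sum big_seq big1// => p /sS/fS.
by rewrite linearZ /= => ->; rewrite scaler0.
Qed.

Lemma rep_cl (U : lmodType K) (f : {linear V -> U}) v :
  (forall s, S s -> f s = 0) -> f (rep (cl S v)) = f v.
Proof.
move=> fS; apply/eqP; rewrite -subr_eq0 -linearB; apply/eqP.
by apply: span_kernel fS _; apply/clP; rewrite repK.
Qed.

Lemma cl_eq0 v : cl S v = 0 <-> span S v.
Proof.
have -> : cl S v = 0 <-> cl S v = cl S 0 by rewrite linear0.
by rewrite clP subr0.
Qed.

End Quotients.

(** * The tensor and exterior algebras *)

Section WordAlgebra.
Variables (K : fieldType) (ext : bool).

(** The relations of the tensor algebra for ext = false, of the exterior algebra
    for ext = true: one parameter serves both theories. *)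
Definition wrel (V : lmodType K) : set (words V) :=
  if ext then exterior_rel V else tensor_rel V.
Arguments wrel V _ : clear implicits.

Definition walg (V : lmodType K) : Type := quot (wrel V).
HB.instance Definition _ V := GRing.Lmodule.on (walg V).

Definition mono (V : lmodType K) (s : seq V) : walg V := cl (wrel V) (word s).

Section Lift.
Variables V U : lmodType K.

(** The universal property of the word algebras. Vanishing on two equal adjacent
    letters is easier to check than vanishing on all words with a repetition,
    and implies it by compatible_dup. *)
Record compatible (f : seq V -> U) : Prop := Compatible {
  compatible_lin : forall s1 s2 a x y,
    f (s1 ++ (a *: x + y) :: s2) = a *: f (s1 ++ x :: s2) + f (s1 ++ y :: s2);
  compatible_alt : ext -> forall s1 x s2, f (s1 ++ x :: x :: s2) = 0
}.

Lemma compatible_swap f s1 x y s2 : ext -> compatible f ->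
  f (s1 ++ x :: y :: s2) = - f (s1 ++ y :: x :: s2).
Proof.
move=> e [fl /(_ e) fa]; apply/eqP; rewrite -addr_eq0; apply/eqP.
have fD r u v t : f (r ++ (u + v) :: t) = f (r ++ u :: t) + f (r ++ v :: t).
  by have := fl r t 1 u v; rewrite !scale1r.
have := fa s1 (x + y) s2; rewrite fD -!(cat_rcons _ s1) !fD !cat_rcons !fa.
by rewrite addr0 add0r.
Qed.

(** Adjacent letters anticommute, so the two equal letters can be brought
    together. *)
Lemma compatible_dup f s : ext -> compatible f -> ~~ uniq s -> f s = 0.
Proof.
move=> e fc; rewrite -[s]cat0s => us.
have {us}: ~~ uniq s by rewrite cat0s in us.
elim: s [::] => //= x s IHs p.
rewrite negb_and negbK => /orP[|/(IHs (rcons p x))]; last by rewrite cat_rcons.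
case/path.splitPr => s1 s2; elim: s1 p => [|y s1 IHt] p.
  by case: fc => _ /(_ e) ->.
rewrite /= (compatible_swap _ _ _ _ e fc) -cat_rcons.
by rewrite IHt oppr0.
Qed.

Lemma compatible_rel f w : compatible f -> wrel V w -> fglift f w = 0.
Proof.
move=> fc; have lin : @multilinear_rel K V w -> fglift f w = 0.
  move=> [s1 [s2 [a [x [y ->]]]]]; rewrite !linearB linearZ /= !fglift1.
  by case: fc => -> _; rewrite addrAC addrK subrr.
rewrite /wrel; case: ifP => // e [/lin//|[s us ->]].
by rewrite fglift1 (compatible_dup e fc).
Qed.

Record cfun := Cfun { cfun_fun :> seq V -> U; cfunP : compatible cfun_fun }.

(** The compatibility proof is bundled in cfun so that wlift f is canonically
    linear. *)
Definition wlift (f : cfun) (t : walg V) : U := fglift f (rep t).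

Lemma wlift_cl (f : cfun) w : wlift f (cl (wrel V) w) = fglift f w.
Proof.
by apply: (rep_cl (f := fglift f)) => s; apply: compatible_rel (cfunP f).
Qed.

Lemma wliftE (f : cfun) s : wlift f (mono s) = f s.
Proof. by rewrite wlift_cl fglift1. Qed.

Lemma wlift_is_linear (f : cfun) : linear (wlift f).
Proof.
by move=> a u v; rewrite -[u]repK -[v]repK -linearP !wlift_cl linearP.
Qed.

HB.instance Definition _ (f : cfun) :=
  GRing.isLinear.Build K (walg V) U _ (wlift f) (wlift_is_linear f).

End Lift.

Lemma walg_ind (V : lmodType K) (P : walg V -> Prop) :
    (forall s, P (mono s)) ->
    (forall a u v, P u -> P v -> P (a *: u + v)) -> forall u, P u.
Proof.
move=> P1 PD u; rewrite -[u]repK; elim/freeg_ind: (rep u) => [|s|a v w IHv IHw].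
(* 0 is reached as - 1 + 1 *)
- have := PD (-1) _ _ (P1 [::]) (P1 [::]).
  by rewrite scaleN1r addNr linear0.
- exact: P1.
- by rewrite linearP; apply: PD.
Qed.

Section Algebra.
Variable V : lmodType K.

Lemma mono_compatible : compatible (@mono V).
Proof.
split=> [s1 s2 a x y|e s1 x s2].
  rewrite -linearP; apply/clP; apply: sub_span; rewrite /wrel.
  have r : @multilinear_rel K V (word (s1 ++ (a *: x + y) :: s2) -
      (a *: word (s1 ++ x :: s2) + word (s1 ++ y :: s2))).
    by exists s1, s2, a, x, y; rewrite opprD addrA.
  by case: ifP => // _; left.
apply/cl_eq0; apply: sub_span; rewrite /wrel e; right.
by exists (s1 ++ x :: x :: s2) => //; rewrite cat_uniq /= inE eqxx !andbF.
Qed.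

Lemma catl_compatible (s : seq V) : compatible (fun t => mono (s ++ t)).
Proof.
by case: mono_compatible => l a; split=> *; rewrite !catA ?l ?a.
Qed.

Definition wmul (u v : walg V) : walg V :=
  fglift (fun s => wlift (Cfun (catl_compatible s)) v) (rep u).

Lemma catr_compatible (v : walg V) :
  compatible (fun s => wlift (Cfun (catl_compatible s)) v).
Proof.
case: mono_compatible => l al; split=> [s1 s2 a x y|e s1 x s2].
  elim/walg_ind: v => [s|b u v IHu IHv]; first by rewrite !wliftE /= -!catA /= l.
  rewrite !linearP /= IHu IHv !scalerDr !scalerA (mulrC b).
  by rewrite -!addrA; congr (_ + _); rewrite addrCA.
elim/walg_ind: v => [s|b u v IHu IHv]; first by rewrite !wliftE /= -!catA /= al.
by rewrite !linearP /= IHu IHv scaler0 addr0.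
Qed.

Lemma wmulE u v : wmul u v = wlift (Cfun (catr_compatible v)) u.
Proof. by []. Qed.

Lemma wmul_linearr u : linear (wmul u).
Proof.
move=> a v w; elim/walg_ind: u => [s|b u1 u2 IH1 IH2].
  by rewrite !wmulE !wliftE /= linearP.
rewrite !wmulE !linearP /= -!wmulE IH1 IH2 !scalerDr !scalerA (mulrC b).
by rewrite -!addrA; congr (_ + _); rewrite addrCA.
Qed.

Lemma wmul_linearl v : linear (wmul^~ v).
Proof. by move=> a u w; rewrite !wmulE linearP. Qed.

Lemma mono_mul s t : wmul (mono s) (mono t) = mono (s ++ t).
Proof. by rewrite wmulE wliftE /= wliftE. Qed.

HB.instance Definition _ u :=
  GRing.isLinear.Build K _ _ _ (wmul u) (wmul_linearr u).

Lemma wmulZl a u v : wmul (a *: u) v = a *: wmul u v.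
Proof.
have := wmul_linearl v a u 0; rewrite !addr0 => ->.
by rewrite [wmul 0 v]wmulE linear0 addr0.
Qed.

Lemma wmulDl : left_distributive wmul +%R.
Proof.
by move=> u v w; have := wmul_linearl w 1 u v; rewrite !scale1r.
Qed.

Lemma wmulDr : right_distributive wmul +%R.
Proof. by move=> u v w; rewrite linearD. Qed.

Lemma wmulA : associative wmul.
Proof.
move=> u v w; elim/walg_ind: u => [s|a u1 u2 I1 I2]; last first.
  by rewrite !(wmulDl, wmulZl) I1 I2.
elim/walg_ind: v => [t|a u1 u2 I1 I2]; last first.
  by rewrite !(linearP, wmulDl, wmulZl) /= I1 I2.
elim/walg_ind: w => [r|a u1 u2 I1 I2]; last by rewrite !linearP /= I1 I2.
by rewrite !mono_mul catA.
Qed.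

Lemma wmul1r : left_id (mono [::]) wmul.
Proof.
elim/walg_ind=> [s|a u v Iu Iv]; first by rewrite mono_mul.
by rewrite linearP /= Iu Iv.
Qed.

Lemma wmulr1 : right_id (mono [::]) wmul.
Proof.
elim/walg_ind=> [s|a u v Iu Iv]; first by rewrite mono_mul cats0.
by rewrite wmulDl wmulZl Iu Iv.
Qed.

HB.instance Definition _ := GRing.Zmodule_isPzRing.Build (walg V)
  wmulA wmul1r wmulr1 wmulDl wmulDr.

Lemma mono_cat s t : mono (s ++ t) = mono s * mono t :> walg V.
Proof. by rewrite -mono_mul. Qed.

Lemma mono_nil : mono [::] = 1 :> walg V. Proof. by []. Qed.

Definition letter (x : V) : walg V := mono [:: x].

Lemma letter_is_linear : linear letter.
Proof. by move=> a x y; rewrite /letter (compatible_lin mono_compatible [::]). Qed.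

HB.instance Definition _ := GRing.isLinear.Build K _ _ _ letter letter_is_linear.

Lemma mono_cons x s : mono (x :: s) = letter x * mono s.
Proof. by rewrite -mono_cat. Qed.

Lemma mono_rcons s x : mono (rcons s x) = mono s * letter x.
Proof. by rewrite -mono_cat cats1. Qed.

Lemma wscaleAl a (u v : walg V) : (a *: u) * v = a *: (u * v).
Proof. exact: wmulZl. Qed.

Lemma wscaleAr a (u v : walg V) : u * (a *: v) = a *: (u * v).
Proof. by rewrite -[LHS]/(wmul u (a *: v)) linearZ. Qed.

Lemma letter_sqr x : ext -> letter x * letter x = 0.
Proof. by move=> e; rewrite -mono_cat (compatible_alt mono_compatible e [::]). Qed.

Lemma letter_anticomm x y : ext -> letter x * letter y = - (letter y * letter x).
Proof.
by move=> e; rewrite -!mono_cat (compatible_swap [::] _ _ _ e mono_compatible).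
Qed.

Lemma walg_rcons_ind (P : walg V -> Prop) :
    P 1 -> (forall u x, P u -> P (u * letter x)) ->
    (forall a u v, P u -> P v -> P (a *: u + v)) -> forall u, P u.
Proof.
move=> P1 PM; apply: walg_ind => s; elim/last_ind: s => // s x.
by rewrite mono_rcons; apply: PM.
Qed.

Lemma walg_cons_ind (P : walg V -> Prop) :
    P 1 -> (forall x u, P u -> P (letter x * u)) ->
    (forall a u v, P u -> P v -> P (a *: u + v)) -> forall u, P u.
Proof.
move=> P1 PM; apply: walg_ind; elim => // x s.
by rewrite mono_cons; apply: PM.
Qed.

End Algebra.
End WordAlgebra.
Arguments wrel {K} ext V _.

(** * Sweedler calculus *)

(** Packs a linearity proof, for maps that have no canonical structure. *)
Definition linear_of (K : fieldType) (U W : lmodType K) (f : U -> W)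
    (fl : linear f) : {linear U -> W} :=
  HB.pack f (GRing.isLinear.Build _ _ _ _ f fl).

Section TensorLift.
Variables (K : fieldType) (V W U : lmodType K).

Definition is_bilinear (f : V -> W -> U) : Prop :=
  (forall z, linear (f^~ z)) /\ (forall y, linear (f y)).

Lemma tensor_lift_cl (f : V -> W -> U) D : is_bilinear f ->
  tensor_lift f (cl (@bilinear_rel K V W) D) = fglift (fun p => f p.1 p.2) D.
Proof.
move=> [fl fr]; apply: (rep_cl (f := fglift (fun p : V * W => f p.1 p.2))).
move=> s [[a [x [y [z ->]]]]|[a [x [y [z ->]]]]];
  by rewrite !linearB linearZ /= !fglift1 /= ?fl ?fr addrAC addrK subrr.
Qed.

Lemma tensor_lift_linear f : is_bilinear f -> linear (tensor_lift f).
Proof.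
move=> fb a u v; rewrite -[u]repK -[v]repK -linearP !tensor_lift_cl//.
by rewrite linearP.
Qed.

Lemma tensor_lift_pure f y z : is_bilinear f -> tensor_lift f (pure y z) = f y z.
Proof. by move=> fb; rewrite tensor_lift_cl// fglift1. Qed.

End TensorLift.

Section Sweedler.
Variables (K : fieldType) (C : lmodType K).
Variables (Delta : {linear C -> tensor C C}) (eps : {linear C -> K^o}).
Local Notation sweedler := (sweedler Delta).

Section Maps.
Variable U : lmodType K.
Implicit Types f g : C -> C -> U.

Lemma eq_sweedler f g x : (forall y z, f y z = g y z) ->
  sweedler f x = sweedler g x.
Proof. by move=> fg; apply: eq_fglift => p; apply: fg. Qed.

Lemma sweedler_lincomb a f g x :
  sweedler (fun y z => a *: f y z + g y z) x = a *: sweedler f x + sweedler g x.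
Proof. exact: fglift_lincomb. Qed.

Lemma sweedlerD f g x :
  sweedler (fun y z => f y z + g y z) x = sweedler f x + sweedler g x.
Proof.
have := sweedler_lincomb 1 f g x; rewrite scale1r => <-.
by apply: eq_sweedler => y z; rewrite scale1r.
Qed.

Lemma sweedler0 x : sweedler (fun _ _ => 0 : U) x = 0.
Proof.
have := sweedlerD (fun _ _ => 0) (fun _ _ => 0) x.
rewrite (eq_sweedler (g := fun _ _ => 0)) => [|y z]; last by rewrite addr0.
by move=> /eqP; rewrite -subr_eq0 opprD addrA subrr sub0r oppr_eq0 => /eqP.
Qed.

Lemma sweedler_sum (I : Type) (r : seq I) (F : I -> C -> C -> U) x :
  sweedler (fun y z => \sum_(i <- r) F i y z) x = \sum_(i <- r) sweedler (F i) x.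
Proof.
elim: r => [|i r IHr].
  rewrite big_nil -[RHS](sweedler0 x).
  by apply: eq_sweedler => y z; rewrite big_nil.
rewrite big_cons -IHr -sweedlerD.
by apply: eq_sweedler => y z; rewrite big_cons.
Qed.

Lemma sweedler_comp (W : lmodType K) (g : {linear U -> W}) f x :
  g (sweedler f x) = sweedler (fun y z => g (f y z)) x.
Proof. exact: fglift_linear_comp. Qed.

End Maps.

Lemma sweedler_linear (U : lmodType K) (f : C -> C -> U) :
  is_bilinear f -> linear (sweedler f).
Proof. by move=> fb a x y; rewrite /Defs.sweedler linearP tensor_lift_linear. Qed.

Lemma sweedlerC (U : lmodType K) (f : C -> C -> U) x :
    cocommutative Delta -> is_bilinear f ->
  sweedler f x = sweedler (fun y z => f z y) x.
Proof.
move=> cC fb; rewrite {1}/Defs.sweedler -[Delta x]cC.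
rewrite -[LHS]/(linear_of (tensor_lift_linear fb) _) sweedler_comp.
by apply: eq_sweedler => y z; apply: tensor_lift_pure.
Qed.

Section Coassociativity.
Variable U : lmodType K.
Hypothesis coalgC : is_coalgebra Delta eps.

(** The equation of coassociativity lives in a triple tensor product; it is
    transported along the linear map induced by the trilinear F. *)
Lemma sweedlerA (F : C -> C -> C -> U) x :
    (forall u v, linear (F u v)) -> (forall u z, linear (fun v => F u v z)) ->
    (forall v z, linear (fun u => F u v z)) ->
  sweedler (fun y z => sweedler (fun u v => F u v z) y) x =
  sweedler (fun y z => sweedler (fun u v => F y u v) z) x.
Proof.
move=> F3 F2 F1.
have Fb u : is_bilinear (F u) by split=> [z|v]; [apply: F2|apply: F3].
pose G1 u t := tensor_lift (F u) t.
have G1b : is_bilinear G1.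
  split=> [t a u v|u]; last exact: tensor_lift_linear.
  rewrite /G1 /tensor_lift -fglift_lincomb.
  by apply: eq_fglift => p; apply: F1.
pose G := linear_of (tensor_lift_linear G1b).
have GE u v z : G (pure u (pure v z)) = F u v z.
  by rewrite /G /= tensor_lift_pure// /G1 tensor_lift_pure.
have := congr1 G (coassociative coalgC x); rewrite !sweedler_comp => E.
rewrite -(eq_sweedler (f := fun y z =>
   G (sweedler (fun u v : C => pure u (pure v z)) y))); last first.
  by move=> y z; rewrite sweedler_comp; apply: eq_sweedler => u v.
rewrite E; apply: eq_sweedler => y z.
by rewrite sweedler_comp; apply: eq_sweedler => u v.
Qed.

Lemma sweedler_counitl (f : {linear C -> U}) x :
  sweedler (fun y z => eps y *: f z) x = f x.
Proof.
rewrite -[in RHS](counit_l coalgC x) sweedler_comp.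
by apply: eq_sweedler => y z; rewrite linearZ.
Qed.

Lemma sweedler_counitr (f : {linear C -> U}) x :
  sweedler (fun y z => eps z *: f y) x = f x.
Proof.
rewrite -[in RHS](counit_r coalgC x) sweedler_comp.
by apply: eq_sweedler => y z; rewrite linearZ.
Qed.

End Coassociativity.
End Sweedler.

(** * Matrices of finite support *)

Section Amul.
Variables (K : fieldType) (A : unitalAlgType K).

HB.instance Definition _ (a : A) :=
  GRing.isLinear.Build K A A _ (amul a) (amul_linearr a).

(** Right multiplication as a function of its own, to carry a linear
    structure. *)
Definition ramul (b : A) := amul^~ b.
HB.instance Definition _ (b : A) :=
  GRing.isLinear.Build K A A _ (ramul b) (amul_linearl b).

Lemma amulDl (a b c : A) : amul (a + b) c = amul a c + amul b c.
Proof. exact: (linearD (ramul c)). Qed.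

Lemma amulZl k (a c : A) : amul (k *: a) c = k *: amul a c.
Proof. by rewrite -[LHS]/(ramul c _) linearZ. Qed.

Lemma amul_suml (I : Type) (r : seq I) (P : pred I) (F : I -> A) c :
  amul (\sum_(i <- r | P i) F i) c = \sum_(i <- r | P i) amul (F i) c.
Proof. exact: (linear_sum (ramul c)). Qed.

End Amul.

Section GlModuleTheory.
Variables (K : fieldType) (V : lmodType K).
Implicit Types a b : gl V.

Lemma gl_eq a b : (forall i j, a i j = b i j) -> a = b.
Proof. by move=> ab; apply/val_inj/funext => i; apply/funext => j; apply: ab. Qed.

Lemma gl_linE k a b i j : (k *: a + b) i j = k *: a i j + b i j.
Proof. by []. Qed.
Lemma gl_subE a b i j : (a - b) i j = a i j - b i j. Proof. by []. Qed.
Lemma gl_scaleE k a i j : (k *: a) i j = k *: a i j. Proof. by []. Qed.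

Definition gl_entry i j (a : gl V) : V := a i j.
Lemma gl_entry_is_linear i j : linear (gl_entry i j). Proof. by []. Qed.
HB.instance Definition _ i j :=
  GRing.isLinear.Build K (gl V) V _ (gl_entry i j) (gl_entry_is_linear i j).

Lemma gl_sumE (I : Type) (r : seq I) (P : pred I) (F : I -> gl V) i j :
  (\sum_(x <- r | P x) F x) i j = \sum_(x <- r | P x) F x i j.
Proof. exact: (linear_sum (gl_entry i j)). Qed.

Definition bounded_by (n : nat) a :=
  forall i j, (n <= i)%N || (n <= j)%N -> a i j = 0.

Lemma bounded_byW n m a : (n <= m)%N -> bounded_by n a -> bounded_by m a.
Proof.
move=> nm an i j /orP[] mi; apply: an; first by rewrite (leq_trans nm mi).
by rewrite (leq_trans nm mi) orbT.
Qed.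

Lemma elem_subproof k l (x : V) :
  (fun i j => if (i == k) && (j == l) then x else 0) \in @bounded_mx K V.
Proof.
apply/asboolP; exists (maxn k l).+1 => i j; case: ifP => // /andP[/eqP-> /eqP->].
by rewrite !gtn_max !ltnn andbF.
Qed.

Definition elem k l (x : V) : gl V := Gl (elem_subproof k l x).

Lemma elem_is_linear k l : linear (elem k l).
Proof.
move=> c x y; apply: gl_eq => i j; rewrite gl_linE /=.
by case: ifP; rewrite ?scaler0 ?addr0.
Qed.

HB.instance Definition _ k l :=
  GRing.isLinear.Build K V (gl V) _ (elem k l) (elem_is_linear k l).

Lemma elem_sum n a : bounded_by n a ->
  a = \sum_(k < n) \sum_(l < n) elem k l (a k l).
Proof.
move=> an; apply: gl_eq => i j; rewrite gl_sumE.
have [ni|ni] := leqP n i.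
  rewrite an ?ni// big1// => k _; rewrite gl_sumE big1// => l _ /=.
  by rewrite gtn_eqF// (leq_trans _ ni).
rewrite (bigD1 (Ordinal ni))//= [X in _ + X]big1 ?addr0; last first.
  move=> k kni; rewrite gl_sumE big1// => l _ /=.
  by case: eqP => //= ik; case/eqP: kni; apply: val_inj.
rewrite gl_sumE; have [nj|nj] := leqP n j.
  rewrite an ?nj ?orbT// big1// => l _ /=.
  by rewrite [j == _]gtn_eqF ?andbF// (leq_trans _ nj).
rewrite (bigD1 (Ordinal nj))//= !eqxx /= big1 ?addr0// => l lnj /=.
by case: eqP => //= jl; case/eqP: lnj; apply: val_inj.
Qed.

End GlModuleTheory.

Section GlMap.
Variables (K : fieldType) (V W : lmodType K) (f : {linear V -> W}).

Lemma gl_map_is_linear : linear (gl_map f).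
Proof. by move=> c x y; apply: gl_eq => i j; rewrite gl_linE /= linearP. Qed.

HB.instance Definition _ :=
  GRing.isLinear.Build K (gl V) (gl W) _ (gl_map f) gl_map_is_linear.

Lemma gl_map_elem k l x : gl_map f (elem k l x) = elem k l (f x).
Proof. by apply: gl_eq => i j /=; case: ifP => // _; rewrite linear0. Qed.

Lemma gl_map_oplus a b : gl_map f (oplus a b) = oplus (gl_map f a) (gl_map f b).
Proof.
by apply: gl_eq => i j /=; case: ifP => // _; [rewrite linear0 | case: ifP].
Qed.

End GlMap.

Section GlLie.
Variables (K : fieldType) (A : unitalAlgType K).
Implicit Types a b c g h : gl A.

(** A matrix product is a sum over all of nat; any bound on the support of the
    terms turns it into an ordinary finite sum. *)
Lemma gl_mulE n a b i j :
    (forall k, (n <= k)%N -> amul (a i k) (b k j) = 0) ->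
  gl_mul a b i j = \sum_(0 <= k < n) amul (a i k) (b k j).
Proof.
move=> abn; rewrite /= (fsbigE (index_iota 0 n))//.
- by rewrite big_mkcond; apply: eq_bigr => k _; rewrite ifT// inE.
- exact: iota_uniq.
- by move=> k _; rewrite mem_index_iota /= -leqNgt; apply: abn.
Qed.

Lemma gl_mulEl n a b i j : bounded_by n a ->
  gl_mul a b i j = \sum_(0 <= k < n) amul (a i k) (b k j).
Proof. by move=> an; apply: gl_mulE => k nk; rewrite an ?nk ?orbT// amul0r. Qed.

Lemma gl_mulEr n a b i j : bounded_by n b ->
  gl_mul a b i j = \sum_(0 <= k < n) amul (a i k) (b k j).
Proof. by move=> bn; apply: gl_mulE => k nk; rewrite bn ?nk// amulr0. Qed.

Lemma gl_mulA : associative (@gl_mul K A).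
Proof.
move=> a b c; apply: gl_eq => i j; have [n bn] := gl_bounded b.
rewrite (@gl_mulE n); last first.
  move=> k nk; rewrite (gl_mulEl _ _ _ bn) big1 ?amulr0// => l _.
  by rewrite bn ?nk// amul0r.
rewrite (@gl_mulE n _ c); last first.
  move=> k nk; rewrite (gl_mulEr _ _ _ bn) big1 ?amul0r// => l _.
  by rewrite bn ?nk ?orbT// amulr0.
under eq_bigr => k _ do rewrite (gl_mulEl _ _ _ bn) linear_sum.
rewrite exchange_big; apply: eq_bigr => k _.
rewrite (gl_mulEr _ _ _ bn) amul_suml.
by apply: eq_bigr => l _; rewrite /= amulA.
Qed.

Lemma gl_mul_linearr a : linear (gl_mul a).
Proof.
move=> t b c; apply: gl_eq => i j; have [n an] := gl_bounded a.
rewrite gl_linE !(gl_mulEl _ _ _ an) scaler_sumr -big_split.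
by apply: eq_bigr => k _; rewrite gl_linE linearP.
Qed.

Lemma gl_mul_linearl t a c b :
  gl_mul (t *: a + c) b = t *: gl_mul a b + gl_mul c b.
Proof.
apply: gl_eq => i j; have [n bn] := gl_bounded b.
rewrite gl_linE !(gl_mulEr _ _ _ bn) scaler_sumr -big_split.
by apply: eq_bigr => k _; rewrite gl_linE amulDl amulZl.
Qed.

Lemma lie_linearr a : linear (lie a).
Proof.
move=> t b c; rewrite /lie gl_mul_linearr gl_mul_linearl.
by rewrite scalerBr opprD addrACA.
Qed.

Lemma lie_antisym a b : lie a b = - lie b a.
Proof. by rewrite /lie opprB. Qed.

Lemma lie_linearl b : linear (fun a => lie a b).
Proof.
by move=> t a c /=; rewrite lie_antisym lie_linearr opprD -scalerN -!lie_antisym.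
Qed.

Lemma lie_self a : lie a a = 0. Proof. exact: subrr. Qed.

HB.instance Definition _ a :=
  GRing.isLinear.Build K (gl A) (gl A) _ (lie a) (lie_linearr a).

Lemma gl_mulBr a b c : gl_mul a (b - c) = gl_mul a b - gl_mul a c.
Proof. exact: (linearB (linear_of (gl_mul_linearr a))). Qed.
Lemma gl_mulBl a b c : gl_mul (b - c) a = gl_mul b a - gl_mul c a.
Proof.
have l : linear (fun b => gl_mul b a) by move=> t u v; apply: gl_mul_linearl.
exact: (linearB (linear_of l)).
Qed.

Lemma lie_jacobi g a b : lie g (lie a b) = lie (lie g a) b + lie a (lie g b).
Proof.
rewrite /lie !(gl_mulBr, gl_mulBl) !gl_mulA.
rewrite !opprB !addrA.
rewrite [RHS](ACl (1 * 8 * 3 * 6 * (2 * 5) * (4 * 7)))%AC /=.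
by rewrite !addNr !addr0.
Qed.

Lemma elem_mul (i j k l : nat) (x y : A) :
  gl_mul (elem i j x) (elem k l y) = (j == k)%:R *: elem i l (amul x y).
Proof.
apply: gl_eq => p q; rewrite gl_scaleE (@gl_mulE j.+1) => [|m jm]; last first.
  by rewrite /= [m == j]gtn_eqF// andbF amul0r.
rewrite big_nat_recr//= big_nat big1 ?add0r => [|m mj]; last first.
  by rewrite [m == j]ltn_eqF// andbF amul0r.
rewrite eqxx andbT.
by case: (p == i); case: (j == k); case: (q == l);
  rewrite /= ?amul0r ?amulr0 ?scale0r ?scaler0 ?scale1r.
Qed.

Lemma gl_scalar_elem i j : gl_scalar A (elem i j 1) = elem i j aone.
Proof. by rewrite /gl_scalar gl_map_elem /= /alg_scalar scale1r. Qed.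

Lemma lie_elem (i j k l : nat) (x : A) :
  lie (gl_scalar A (elem i j 1)) (elem k l x) =
  (j == k)%:R *: elem i l x - (l == i)%:R *: elem k j x.
Proof. by rewrite gl_scalar_elem /lie !elem_mul amul1r amulr1. Qed.

Lemma oplus_mul a b c d :
  gl_mul (oplus a b) (oplus c d) = oplus (gl_mul a c) (gl_mul b d).
Proof.
have [n an] := gl_bounded a; have [m bm] := gl_bounded b.
pose r := maxn n m; apply: gl_eq => i j.
have {}an : bounded_by r a by apply: bounded_byW an; rewrite leq_maxl.
have {}bm : bounded_by r b by apply: bounded_byW bm; rewrite leq_maxr.
have -> : oplus (gl_mul a c) (gl_mul b d) i j =
    if odd i != odd j then 0 else
    if odd i then gl_mul b d i./2 j./2 else gl_mul a c i./2 j./2 by [].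
rewrite (gl_mulEl _ _ _ bm) (gl_mulEl _ _ _ an).
rewrite (@gl_mulE r.*2) => [|k rk]; last first.
  rewrite /=; have {}rk : (r <= k./2)%N by rewrite -[r]doubleK half_leq.
  case: ifP => _; first by rewrite amul0r.
  by case: ifP => _; rewrite ?bm ?an ?rk ?orbT// amul0r.
have -> : \sum_(0 <= k < r.*2) amul (oplus a b i k) (oplus c d k j) =
    \sum_(0 <= k < r) (amul (oplus a b i k.*2) (oplus c d k.*2 j) +
                       amul (oplus a b i k.*2.+1) (oplus c d k.*2.+1 j)).
  elim: r {an bm} => [|r IHr]; first by rewrite !big_geq.
  by rewrite doubleS !big_nat_recr//= IHr addrA.
have half2 k : k.*2.+1./2 = k by rewrite /= uphalf_double.
case oi: (odd i); case oj: (odd j) => /=.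
- apply: eq_bigr => k _.
  by rewrite !odd_double oi oj /= amul0r add0r uphalf_double.
- rewrite big1// => k _.
  by rewrite !odd_double oi oj /= amul0r amulr0 addr0.
- rewrite big1// => k _.
  by rewrite !odd_double oi oj /= amul0r amulr0 addr0.
- apply: eq_bigr => k _.
  by rewrite !odd_double oi oj /= amul0r addr0 doubleK.
Qed.

Lemma oplus_sub a b c d : oplus a b - oplus c d = oplus (a - c) (b - d).
Proof.
apply: gl_eq => i j; rewrite gl_subE /=.
by case: ifP => _; [rewrite subrr | case: ifP].
Qed.

Lemma oplus_lie a b c d : lie (oplus a b) (oplus c d) = oplus (lie a c) (lie b d).
Proof. by rewrite /lie !oplus_mul oplus_sub. Qed.

Lemma lie0r a : lie a 0 = 0. Proof. exact: linear0. Qed.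
Lemma lie0l a : lie 0 a = 0. Proof. by rewrite lie_antisym lie0r oppr0. Qed.

End GlLie.

Section OplusInjections.
Variables (K : fieldType) (V : lmodType K).

Definition inl_gl (a : gl V) := oplus a 0.
Definition inr_gl (b : gl V) := oplus 0 b.

Lemma inl_gl_is_linear : linear inl_gl.
Proof.
move=> k a b; apply: gl_eq => i j; rewrite gl_linE /=.
by case: ifP => _; [|case: ifP => _]; rewrite ?scaler0 ?addr0.
Qed.

Lemma inr_gl_is_linear : linear inr_gl.
Proof.
move=> k a b; apply: gl_eq => i j; rewrite gl_linE /=.
by case: ifP => _; [|case: ifP => _]; rewrite ?scaler0 ?addr0.
Qed.

HB.instance Definition _ :=
  GRing.isLinear.Build K (gl V) (gl V) _ inl_gl inl_gl_is_linear.
HB.instance Definition _ :=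
  GRing.isLinear.Build K (gl V) (gl V) _ inr_gl inr_gl_is_linear.

End OplusInjections.

Section OplusLie.
Variables (K : fieldType) (A : unitalAlgType K).
Implicit Types a b : gl A.

Lemma inl_lie a b : inl_gl (lie a b) = lie (inl_gl a) (inl_gl b).
Proof. by rewrite /inl_gl oplus_lie lie0r. Qed.
Lemma inr_lie a b : inr_gl (lie a b) = lie (inr_gl a) (inr_gl b).
Proof. by rewrite /inr_gl oplus_lie lie0r. Qed.
(** The two summands of oplus commute. This is what makes the product of
    chains compatible with the differential. *)
Lemma inl_inr_lie a b : lie (inl_gl a) (inr_gl b) = 0.
Proof.
rewrite /inl_gl /inr_gl oplus_lie lie0r lie0l.
by apply: gl_eq => i j /=; rewrite !if_same.
Qed.

Lemma gl_scalar_inl g : gl_scalar A (inl_gl g) = inl_gl (gl_scalar A g).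
Proof. by rewrite /gl_scalar /inl_gl gl_map_oplus linear0. Qed.
Lemma gl_scalar_inr g : gl_scalar A (inr_gl g) = inr_gl (gl_scalar A g).
Proof. by rewrite /gl_scalar /inr_gl gl_map_oplus linear0. Qed.

End OplusLie.

Section GlMeasuring.
Variables (K : fieldType) (C : lmodType K).
Variables (Delta : {linear C -> tensor C C}) (eps : {linear C -> K^o}).
Variables (A A' : unitalAlgType K) (Phi : C -> {linear A -> A'}).
Hypothesis cC : cocommutative Delta.
Hypothesis measPhi : measuring Delta eps amul aone amul aone (fun x => Phi x).
Local Notation sweedler := (sweedler Delta).

Definition gl_act (x : C) : gl A -> gl A' := gl_map (Phi x).
HB.instance Definition _ x := GRing.Linear.on (gl_act x).

Lemma gl_act_linearC a : linear (gl_act^~ a).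
Proof.
by move=> k x y; apply: gl_eq => i j; rewrite gl_linE /= (measuring_linearC measPhi).
Qed.

Lemma gl_act_mul x a b :
  gl_act x (gl_mul a b) = sweedler (fun y z => gl_mul (gl_act y a) (gl_act z b)) x.
Proof.
apply: gl_eq => i j; have [n an] := gl_bounded a.
rewrite -[RHS]/(gl_entry i j _) sweedler_comp.
rewrite -[LHS]/(Phi x (gl_mul a b i j)) (gl_mulEl _ _ _ an) linear_sum.
under eq_bigr => k _ do rewrite (measuring_mul measPhi).
rewrite -sweedler_sum; apply: eq_sweedler => y z.
rewrite -[RHS]/(gl_mul (gl_act y a) (gl_act z b) i j) (@gl_mulEl _ _ n)// => p q pq.
by rewrite /gl_act /= an// linear0.
Qed.

(** The term b a of the commutator comes out with the two Sweedler factors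
    exchanged, whence the need for cocommutativity. *)
Lemma gl_act_lie x a b :
  gl_act x (lie a b) = sweedler (fun y z => lie (gl_act y a) (gl_act z b)) x.
Proof.
rewrite {1}/lie linearB /= !gl_act_mul [X in _ - X]sweedlerC//; last first.
  split=> [z|y] k u v; rewrite gl_act_linearC.
    by rewrite gl_mul_linearl.
  by rewrite gl_mul_linearr.
rewrite -[X in _ - X]scale1r -scaleNr addrC -sweedler_lincomb.
by apply: eq_sweedler => y z; rewrite scaleN1r addrC.
Qed.

End GlMeasuring.

(** * Derivations and morphisms of the word algebras *)

Section QuotMapLift.
Variables (K : fieldType) (ext : bool) (V W : lmodType K).

(** Identifies the maps that quot_map computes on arbitrary representatives. *)
Lemma quot_map_wlift (S : set (words W)) (f : {linear words V -> words W})
    (c : cfun ext V (quot S)) u :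
  (forall s, cl S (f (word s)) = c s) -> quot_map f u = wlift c u.
Proof.
move=> fc; rewrite /quot_map /wlift.
elim/freeg_ind: (rep u) => [|s|a v w IHv IHw].
- by rewrite !linear0.
- by rewrite fglift1 fc.
- by rewrite !linearP /= IHv IHw.
Qed.

End QuotMapLift.

Section WordMap.
Variables (K : fieldType) (ext : bool) (V W : lmodType K) (f : {linear V -> W}).
Local Notation walg := (walg ext).
Local Notation mono := (mono ext).
Local Notation letter := (letter ext).

Lemma wmap_compatible : compatible ext (fun s => mono [seq f x | x <- s]).
Proof.
case: (@mono_compatible K ext W) => l al.
split=> [s1 s2 a x y|e s1 x s2]; rewrite !map_cat /= ?linearP ?l//.
exact: al.
Qed.

Definition wmap : walg V -> walg W := wlift (Cfun wmap_compatible).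
HB.instance Definition _ := GRing.Linear.on wmap.

Lemma wmap_lin a u v : wmap (a *: u + v) = a *: wmap u + wmap v.
Proof. exact: linearP. Qed.

Lemma wmap_mono s : wmap (mono s) = mono (map f s).
Proof. exact: wliftE. Qed.

Lemma wmap1 : wmap 1 = 1. Proof. exact: wmap_mono. Qed.

Lemma wmap_letter x : wmap (letter x) = letter (f x).
Proof. exact: wmap_mono. Qed.

Lemma wmapM u v : wmap (u * v) = wmap u * wmap v.
Proof.
elim/walg_ind: u => [s|a u1 u2 I1 I2]; last first.
  by rewrite mulrDl wscaleAl !wmap_lin I1 I2 mulrDl wscaleAl.
elim/walg_ind: v => [t|a u1 u2 I1 I2]; last first.
  by rewrite mulrDr wscaleAr !wmap_lin I1 I2 mulrDr wscaleAr.
by rewrite -mono_cat !wmap_mono map_cat mono_cat.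
Qed.

End WordMap.

Section Derivation.
Variables (K : fieldType) (ext : bool) (V : lmodType K).
Local Notation walg := (walg ext).
Local Notation mono := (mono ext).
Local Notation letter := (letter ext).

Section Der.
Variable D : {linear V -> V}.

Definition der_word (s : seq V) : walg V :=
  \sum_(i < size s) mono (set_nth 0 s i (D s`_i)).

Lemma der_word_cons x s :
  der_word (x :: s) = letter (D x) * mono s + letter x * der_word s.
Proof.
rewrite /der_word /= big_ord_recl /= mono_cons mulr_sumr; congr (_ + _).
by apply: eq_bigr => i _; rewrite -mono_cons.
Qed.

Lemma der_word_cat s t :
  der_word (s ++ t) = der_word s * mono t + mono s * der_word t.
Proof.
elim: s => [|x s IHs].
  by rewrite {2}/der_word /= big_ord0 mul0r add0r mono_nil mul1r.
rewrite cat_cons !der_word_cons IHs mono_cat mono_cons mulrDr mulrDl addrA.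
by rewrite !mulrA.
Qed.

Lemma der_word_compatible : compatible ext der_word.
Proof.
split=> [s1 s2 a x y|e s1 x s2]; rewrite !der_word_cat.
  rewrite !der_word_cons !mono_cons !linearP /=.
  rewrite !(mulrDl, mulrDr, wscaleAl, wscaleAr, scalerDr).
  by rewrite !addrA [RHS](ACl (1 * 4 * 2 * 5 * 3 * 6))%AC.
have sq u : letter x * (letter x * u) = 0 by rewrite mulrA letter_sqr// mul0r.
rewrite !der_word_cons !mono_cons [letter x * (_ + _)]mulrDr !sq.
rewrite mulr0 add0r addr0 !mulrA.
by rewrite [letter x * letter _]letter_anticomm// mulNr addrN mulr0.
Qed.

Definition der : walg V -> walg V := wlift (Cfun der_word_compatible).
HB.instance Definition _ := GRing.Linear.on der.

Lemma der_lin a u v : der (a *: u + v) = a *: der u + der v.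
Proof. exact: linearP. Qed.

Lemma der_mono s : der (mono s) = der_word s. Proof. exact: wliftE. Qed.

Lemma der1 : der 1 = 0.
Proof. by rewrite -mono_nil der_mono /der_word big_ord0. Qed.

Lemma derM u v : der (u * v) = der u * v + u * der v.
Proof.
elim/walg_ind: u => [s|a u1 u2 I1 I2]; last first.
  rewrite !(mulrDl, wscaleAl, der_lin) I1 I2 !scalerDr.
  by rewrite addrACA.
elim/walg_ind: v => [t|a u1 u2 I1 I2]; last first.
  rewrite !(mulrDr, wscaleAr, der_lin) I1 I2 !scalerDr.
  by rewrite addrACA.
by rewrite -mono_cat !der_mono der_word_cat.
Qed.

Lemma der_letter x : der (letter x) = letter (D x).
Proof.
by rewrite der_mono der_word_cons mono_nil mulr1 /der_word big_ord0 mulr0 addr0.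
Qed.

End Der.

Lemma der_lincomb (D1 D2 D3 : {linear V -> V}) a u :
  (forall x, D1 x = a *: D2 x + D3 x) -> der D1 u = a *: der D2 u + der D3 u.
Proof.
move=> DE; elim/walg_cons_ind: u => [|x u IHu|b u v IHu IHv].
- by rewrite !der1 scaler0 addr0.
- rewrite !derM !der_letter DE IHu linearP /=.
  rewrite !(mulrDl, mulrDr, wscaleAl, wscaleAr, scalerDr) -!addrA.
  by congr (_ + _); rewrite addrCA.
rewrite !der_lin IHu IHv !scalerDr !scalerA (mulrC b) -!addrA.
by congr (_ + _); rewrite addrCA.
Qed.

Lemma der_comm (D1 D2 D3 : {linear V -> V}) u :
  (forall x, D1 (D2 x) = D2 (D1 x) + D3 x) ->
  der D1 (der D2 u) = der D2 (der D1 u) + der D3 u.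
Proof.
move=> DE; elim/walg_cons_ind: u => [|x u IHu|b u v IHu IHv].
- by rewrite !der1 !linear0 addr0.
- rewrite !derM !der_letter !linearD /= !derM !der_letter DE IHu linearD /=.
  by rewrite mulrDl mulrDr !addrA [RHS](ACl (1 * 5 * 3 * 2 * 4 * 6))%AC.
by rewrite !der_lin IHu IHv scalerDr addrACA.
Qed.

End Derivation.

Lemma der_wmap (K : fieldType) ext (V W : lmodType K) (f : {linear V -> W})
    (D : {linear V -> V}) (D' : {linear W -> W}) (u : walg ext V) :
  (forall x, D' (f x) = f (D x)) -> der D' (wmap f u) = wmap f (der D u).
Proof.
move=> fD; elim/walg_cons_ind: u => [|x u IHu|b u v IHu IHv].
- by rewrite wmap1 !der1 linear0.
- by rewrite wmapM 2!derM [wmap f (_ + _)]linearD /= 2!wmapM der_letter 2!wmap_letter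
    der_letter fD IHu.
by rewrite !(wmap_lin, der_lin) IHu IHv.
Qed.

Section Sign.
Variables (K : fieldType) (ext : bool) (V : lmodType K).
Local Notation walg := (walg ext).
Local Notation mono := (mono ext).
Local Notation letter := (letter ext).

Lemma opp_is_linear : linear (fun x : V => - x).
Proof. by move=> a x y; rewrite opprD scalerN. Qed.

(** The parity involution, (-1) ^ n in degree n: it lets the signs of the
    differential be written without decomposing a chain into its degrees. *)
Definition sgn : walg V -> walg V := wmap (linear_of opp_is_linear).
HB.instance Definition _ := GRing.Linear.on sgn.

Lemma sgn_lin a u v : sgn (a *: u + v) = a *: sgn u + sgn v.
Proof. exact: linearP. Qed.

Lemma sgn1 : sgn 1 = 1. Proof. exact: wmap1. Qed.
Lemma sgnM u v : sgn (u * v) = sgn u * sgn v. Proof. exact: wmapM. Qed.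
Lemma sgn_letter x : sgn (letter x) = - letter x.
Proof. by rewrite /sgn wmap_letter linearN. Qed.

Lemma sgn_mono s : sgn (mono s) = (-1) ^+ size s *: mono s.
Proof.
elim: s => [|x s IHs]; first by rewrite mono_nil sgn1 scale1r.
by rewrite mono_cons sgnM sgn_letter IHs mulNr wscaleAr exprS mulN1r scaleNr.
Qed.

Lemma sgnK u : sgn (sgn u) = u.
Proof.
elim/walg_cons_ind: u => [|x u IHu|b u v IHu IHv].
- by rewrite !sgn1.
- by rewrite !sgnM sgn_letter linearN /= sgn_letter opprK IHu.
by rewrite !sgn_lin IHu IHv.
Qed.

Lemma der_sgn D u : der D (sgn u) = sgn (der D u).
Proof. by apply: der_wmap => x /=; rewrite linearN. Qed.

End Sign.

Lemma wmap_sgn (K : fieldType) ext (V W : lmodType K) (f : {linear V -> W})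
    (u : walg ext V) : wmap f (sgn u) = sgn (wmap f u).
Proof.
elim/walg_cons_ind: u => [|x u IHu|b u v IHu IHv].
- by rewrite sgn1 wmap1 sgn1.
- by rewrite !(wmapM, sgnM) !(sgn_letter, wmap_letter) linearN /= wmap_letter IHu.
by rewrite !(wmap_lin, sgn_lin) IHu IHv.
Qed.

(** * The differential *)

Section Differential.
Variables (K : fieldType) (ext : bool) (A : unitalAlgType K).
Local Notation walg := (walg ext).
Local Notation mono := (mono ext).
Local Notation letter := (letter ext).
Local Notation ad g := (der (ext := ext) (lie g)).
Implicit Types (s : seq (gl A)) (g h : gl A) (u v : walg (gl A)).

(** The Leibniz differential of a word, read in the tensor or in the exterior
    algebra. *)
Definition d_word s : walg (gl A) := cl (wrel ext (gl A)) (d_Leibniz (word s)).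

Lemma d_wordE s : d_word s = \sum_(j < size s) \sum_(i < j)
    (-1) ^+ j.+1 *: mono (del j (set_nth 0 s i (lie s`_i s`_j))).
Proof.
rewrite /d_word /d_Leibniz fglift1 linear_sum; apply: eq_bigr => j _.
by rewrite linear_sum; apply: eq_bigr => i _; rewrite linearZ.
Qed.

(** The terms of the Leibniz differential split into those that do not involve
    the last letter g, and those, all of the same sign, that bracket a letter
    with g. All later facts on the differential come from this recursion by
    induction on the word. *)
Lemma d_word_rcons s g :
  d_word (rcons s g) = d_word s * letter g + ad g (sgn (mono s)).
Proof.
have take_rcons (t : seq (gl A)) y n : (n <= size t)%N -> take n (rcons t y) = take n t.
  by rewrite -cats1; apply: takel_cat.
rewrite !d_wordE size_rcons big_ord_recr /=; congr (_ + _).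
  rewrite mulr_suml; apply: eq_bigr => j _; rewrite mulr_suml.
  apply: eq_bigr => i _; rewrite wscaleAl -mono_rcons !nth_rcons.
  have ij := ltn_trans (ltn_ord i) (ltn_ord j).
  rewrite ltn_ord ij !set_nthE size_rcons ij ltnS (ltnW ij).
  rewrite take_rcons ?(ltnW ij)// drop_rcons// -rcons_cons -rcons_cat.
  set t := take i s ++ _.
  have tj : (j < size t)%N.
    rewrite /t size_cat /= size_drop size_takel ?(ltnW ij)//.
    by rewrite addnS -addSn subnKC.
  by rewrite /del take_rcons ?(ltnW tj)// drop_rcons// rcons_cat.
rewrite sgn_mono linearZ /= der_mono /der_word scaler_sumr.
apply: eq_bigr => i _; rewrite !nth_rcons ltn_ord ltnn eqxx.
rewrite !set_nthE size_rcons ltn_ord ltnS (ltnW (ltn_ord i)).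
rewrite take_rcons ?(ltnW (ltn_ord i))// drop_rcons// -rcons_cons -rcons_cat.
set t := take i s ++ _.
have tE y : size (take i s ++ y :: drop i.+1 s) = size s.
  rewrite size_cat /= size_drop size_takel ?(ltnW (ltn_ord i))//.
  by rewrite addnS -addSn subnKC.
have -> : del (size s) (rcons t g) = t.
  rewrite /del -(tE (lie s`_i g)) -/t take_rcons// take_size.
  by rewrite drop_oversize ?cats0// size_rcons.
rewrite exprS mulN1r scaleNr -scalerN; congr (_ *: _).
rewrite /t lie_antisym mono_cat mono_cons linearN /= mulNr mulrN.
by rewrite -mono_cons -mono_cat opprK.
Qed.

Lemma ad_lincomb a g h u : ad (a *: g + h) u = a *: ad g u + ad h u.
Proof. by apply: der_lincomb => x; apply: lie_linearl. Qed.

Lemma ad_lie g h u : ad g (ad h u) = ad h (ad g u) + ad (lie g h) u.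
Proof. by apply: der_comm => x /=; rewrite lie_jacobi addrC. Qed.

(** For the alternation in u x x: the two terms bracketing a letter of u with
    one of the two x cancel, and the bracket of x with itself is 0. *)
Lemma d_word_compatible : compatible ext d_word.
Proof.
have [l al] := @mono_compatible K ext (gl A).
split=> [s1 s2 a x y|e s1 x s2].
  elim/last_ind: s2 => [|s2 g IHs].
    rewrite !cats1 !d_word_rcons ad_lincomb linearP /= mulrDr wscaleAr.
    by rewrite scalerDr addrACA.
  rewrite -!rcons_cons -!rcons_cat !d_word_rcons IHs l sgn_lin der_lin.
  by rewrite mulrDl wscaleAl scalerDr addrACA.
elim/last_ind: s2 => [|s2 g IHs]; last first.
  by rewrite -!rcons_cons -!rcons_cat d_word_rcons IHs al// !linear0 mul0r addr0.
rewrite -cat_rcons cats1 !d_word_rcons mono_rcons sgnM sgn_letter.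
rewrite derM !mulrDl -mulrA letter_sqr// mulr0 add0r linearN /= der_letter /=.
by rewrite lie_self linear0 oppr0 mulr0 addr0 mulrN addrN.
Qed.

Definition wd : walg (gl A) -> walg (gl A) := wlift (Cfun d_word_compatible).
HB.instance Definition _ := GRing.Linear.on wd.

Lemma wd_lin a u v : wd (a *: u + v) = a *: wd u + wd v.
Proof. exact: linearP. Qed.

Lemma wd_mono s : wd (mono s) = d_word s. Proof. exact: wliftE. Qed.

Lemma wd1 : wd 1 = 0.
Proof. by rewrite -mono_nil wd_mono d_wordE big_ord0. Qed.

Lemma wdM u g : wd (u * letter g) = wd u * letter g + ad g (sgn u).
Proof.
elim/walg_ind: u => [s|a u v IHu IHv].
  by rewrite -mono_rcons !wd_mono d_word_rcons.
by rewrite !(mulrDl, wscaleAl, wd_lin, sgn_lin, der_lin) IHu IHv scalerDr addrACA.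
Qed.

Lemma wd_sgn u : wd (sgn u) = - sgn (wd u).
Proof.
elim/walg_rcons_ind: u => [|u g IHu|b u v IHu IHv].
- by rewrite sgn1 wd1 linear0 oppr0.
- rewrite sgnM sgn_letter mulrN linearN /= !wdM IHu sgnK [sgn (_ + _)]linearD /=.
  by rewrite sgnM sgn_letter -der_sgn sgnK mulrN mulNr.
by rewrite !(sgn_lin, wd_lin) IHu IHv opprD scalerN.
Qed.

(** Cartan's homotopy: right multiplication by g, up to sign, contracts the
    adjoint action of g, which is therefore trivial on homology. *)
Lemma wd_homotopy g u :
  wd (sgn u * letter g) = - (sgn (wd u) * letter g) + ad g u.
Proof. by rewrite wdM wd_sgn sgnK mulNr. Qed.

Lemma wd_ad h u : wd (ad h u) = ad h (wd u).
Proof.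
elim/walg_rcons_ind: u => [|u g IHu|b u v IHu IHv].
- by rewrite der1 wd1 !linear0.
- rewrite wdM [der _ (_ + _)]linearD /= !derM !der_letter.
  rewrite [wd (_ + _)]linearD /= !wdM IHu ad_lie -!der_sgn.
  by rewrite addrACA.
by rewrite !(der_lin, wd_lin) IHu IHv.
Qed.

Lemma wd_wd u : wd (wd u) = 0.
Proof.
elim/walg_rcons_ind: u => [|u g IHu|b u v IHu IHv].
- by rewrite wd1 linear0.
- rewrite wdM linearD /= wdM IHu mul0r add0r wd_ad wd_sgn linearN /=.
  by rewrite addrN.
by rewrite !wd_lin IHu IHv scaler0 addr0.
Qed.

End Differential.

Section Exterior.
Variables (K : fieldType).

Lemma letter_move (V : lmodType K) (x : V) s :
  letter true x * mono true s = (-1) ^+ size s *: (mono true s * letter true x).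
Proof.
elim: s => [|y s IHs]; first by rewrite mono_nil mul1r mulr1 scale1r.
rewrite mono_cons mulrA letter_anticomm// mulNr -(mulrA _ (letter true x)) IHs.
rewrite wscaleAr mulrA.
by rewrite exprS mulN1r scaleNr.
Qed.

Lemma size_del (A : unitalAlgType K) (s : seq (gl A)) j :
  (j < size s)%N -> size (del j s) = (size s).-1.
Proof.
move=> js; rewrite /del size_cat size_drop size_takel ?(ltnW js)//.
by rewrite -[in RHS](subnKC js) addSn.
Qed.

Lemma nth_del (A : unitalAlgType K) (s : seq (gl A)) j k :
  (j < size s)%N -> nth 0 (del j s) k = nth 0 s (bump j k).
Proof.
move=> js; rewrite /del nth_cat size_takel ?(ltnW js)// /bump.
case: (ltnP k j) => jk /=; first by rewrite add0n nth_take.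
by rewrite nth_drop addSn subnKC.
Qed.

Lemma del_set_nth (A : unitalAlgType K) (s : seq (gl A)) y i j :
  (i < j < size s)%N -> del j (set_nth 0 s i y) = set_nth 0 (del j s) i y.
Proof.
move=> /andP[ij js]; have ls := ltn_trans ij js.
have sz : size (set_nth 0 s i y) = size s by rewrite size_set_nth (maxn_idPr ls).
have isd : (i < size (del j s))%N.
  by rewrite size_del//; apply: leq_trans ij _; rewrite -ltnS (ltn_predK js).
apply: (@eq_from_nth _ 0).
  by rewrite size_del ?sz// size_set_nth (maxn_idPr isd) size_del.
move=> k _; rewrite nth_del ?sz// !nth_set_nth /= nth_del//.
congr (if _ then _ else _); rewrite /bump; case: leqP => //= jk.
by rewrite !gtn_eqF// (leq_trans ij)// leqW.
Qed.

(** In the exterior algebra the Chevalley-Eilenberg differential is the Leibniz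
    one: moving the bracket from the front of the word to position i costs the
    sign (-1) ^ i. *)
Lemma d_CE_Leibniz (A : unitalAlgType K) (s : seq (gl A)) :
  cl (wrel true (gl A)) (d_CE (word s)) = d_word true s.
Proof.
rewrite d_wordE /d_CE fglift1 linear_sum; apply: eq_bigr => j _.
rewrite linear_sum; apply: eq_bigr => i _; rewrite linearZ /=.
rewrite -[cl _ (word _)]/(mono true _).
set y := lie _ _.
have ij : (i < j < size s)%N by rewrite ltn_ord ltn_ord.
have it : (i < size (del j s))%N.
  rewrite /del size_cat size_take ltn_ord size_drop.
  by rewrite (leq_trans (ltn_ord i)) ?leq_addr.
rewrite (del_set_nth _ ij) set_nthE it /del.
rewrite -/(del j s) mono_cons !mono_cat mulrA letter_move size_takel ?(ltnW it)//.
rewrite wscaleAl scalerA mono_cons mulrA -exprD; congr (_ *: _).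
by rewrite addSn addnAC addnn !exprS exprD -mul2n exprM sqrrN !expr1n mul1r.
Qed.

End Exterior.

(** * The product *)

Lemma wd_wmap (K : fieldType) ext (A B : unitalAlgType K)
    (f : {linear gl A -> gl B}) (u : walg ext (gl A)) :
  (forall a b, f (lie a b) = lie (f a) (f b)) -> wd (wmap f u) = wmap f (wd u).
Proof.
move=> fl; elim/walg_rcons_ind: u => [|u g IHu|b u v IHu IHv].
- by rewrite wmap1 !wd1 linear0.
- rewrite wmapM wmap_letter !wdM IHu linearD /= wmapM wmap_letter -wmap_sgn.
  by congr (_ + _); apply: der_wmap => x /=; rewrite fl.
by rewrite !(wmap_lin, wd_lin) IHu IHv.
Qed.

Lemma der_wmap0 (K : fieldType) ext (V W : lmodType K) (f : {linear V -> W})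
    (D : {linear W -> W}) (u : walg ext V) :
  (forall x, D (f x) = 0) -> der D (wmap f u) = 0.
Proof.
move=> D0; elim/walg_cons_ind: u => [|x u IHu|b u v IHu IHv].
- by rewrite wmap1 der1.
- rewrite wmapM wmap_letter derM der_letter D0 IHu.
  by rewrite linear0 mul0r mulr0 addr0.
by rewrite !(wmap_lin, der_lin) IHu IHv scaler0 addr0.
Qed.

Section OplusProduct.
Variables (K : fieldType) (ext : bool).

Section Module.
Variable V : lmodType K.
Local Notation walg := (walg ext (gl V)).

(** The product on coinvariants is given by a formula that makes sense for
    chains: concatenation after moving the two factors to commuting copies of
    gl A. *)
Definition wplus (u v : walg) : walg := wmap (@inl_gl K V) u * wmap (@inr_gl K V) v.

Lemma wplus_linearr u : linear (wplus u).
Proof. by move=> a v w; rewrite /wplus linearP /= mulrDr wscaleAr. Qed.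

Lemma wplus_linearl v : linear (wplus^~ v).
Proof. by move=> a u w; rewrite /wplus linearP /= mulrDl wscaleAl. Qed.

HB.instance Definition _ u :=
  GRing.isLinear.Build K walg walg _ (wplus u) (wplus_linearr u).

End Module.

Variable A : unitalAlgType K.
Local Notation walg := (walg ext (gl A)).
Local Notation ad g := (der (ext := ext) (lie g)).
Implicit Types u v : walg.

Lemma cl_oplus_words (w1 w2 : words (gl A)) :
  cl (wrel ext (gl A)) (oplus_words w1 w2) =
  wplus (cl (wrel ext _) w1) (cl (wrel ext _) w2).
Proof.
rewrite /oplus_words.
elim/freeg_ind: w1 => [|s|a v w IHv IHw].
- by rewrite !linear0 /wplus linear0 mul0r.
- rewrite fglift1; elim/freeg_ind: w2 => [|t|a v w IHv IHw].
  + by rewrite !linear0.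
  + by rewrite fglift1 /wplus !wmap_mono -mono_cat.
  + by rewrite !linearP /= IHv IHw.
by rewrite !linearP /= IHv IHw wplus_linearl.
Qed.

Lemma ad_inl_inr g v : ad (inl_gl g) (wmap (@inr_gl K A) v) = 0.
Proof. by apply: der_wmap0 => x /=; rewrite inl_inr_lie. Qed.

Lemma ad_inr_inl g v : ad (inr_gl g) (wmap (@inl_gl K A) v) = 0.
Proof. by apply: der_wmap0 => x /=; rewrite lie_antisym inl_inr_lie oppr0. Qed.

(** The term of the Leibniz rule in which a letter of u is bracketed with a
    letter of v vanishes, as the two copies of gl A commute. *)
Lemma wd_wplus u v : wd (wplus u v) = wplus (wd u) v + wplus (sgn u) (wd v).
Proof.
rewrite /wplus; elim/walg_rcons_ind: v => [|v g IHv|b v w IHv IHw].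
- rewrite wmap1 !mulr1 wd1 linear0 mulr0 addr0.
  by apply: wd_wmap; apply: inl_lie.
- rewrite wmapM wmap_letter mulrA wdM IHv sgnM derM.
  rewrite -wmap_sgn ad_inr_inl mul0r add0r wdM.
  rewrite [wmap _ (_ + _)]linearD /= wmapM wmap_letter -wmap_sgn.
  rewrite (der_wmap (D := lie g)) => [|x]; last by rewrite /= inr_lie.
  by rewrite mulrDl mulrDr !mulrA -!addrA.
rewrite !(wmap_lin, wd_lin, mulrDr, wscaleAr) IHv IHw.
by rewrite scalerDr addrACA.
Qed.

(** Acting on one factor is acting on the product by a matrix of the
    corresponding copy; so the product descends to coinvariants. *)
Lemma wplus_adl g u v : wplus (ad g u) v = ad (inl_gl g) (wplus u v).
Proof.
by rewrite /wplus derM ad_inl_inr mulr0 addr0 (der_wmap (D := lie g)) // => x;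
  rewrite /= inl_lie.
Qed.

Lemma wplus_adr g u v : wplus u (ad g v) = ad (inr_gl g) (wplus u v).
Proof.
by rewrite /wplus derM ad_inr_inl mul0r add0r (der_wmap (D := lie g)) // => x;
  rewrite /= inr_lie.
Qed.

End OplusProduct.

(** * The action of the coalgebra *)

Section Action.
Variables (K : fieldType) (ext : bool).
Hypothesis charK0 : [pchar K] =i pred0.
Variable C : lmodType K.
Variables (Delta : {linear C -> tensor C C}) (eps : {linear C -> K^o}).
Hypotheses (coalgC : is_coalgebra Delta eps) (cC : cocommutative Delta).
Variables (A A' : unitalAlgType K) (Phi : C -> {linear A -> A'}).
Hypothesis measPhi : measuring Delta eps amul aone amul aone (fun x => Phi x).
Local Notation sweedler := (sweedler Delta).
Local Notation walg := (walg ext).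
Local Notation mono := (mono ext).
Local Notation letter := (letter ext).
Local Notation ad g := (der (ext := ext) (lie g)).
Local Notation "x |> a" := (gl_act Phi x a) (at level 35).

Definition act_word (x : C) (s : seq (gl A)) : walg (gl A') :=
  cl (wrel ext (gl A')) (words_action Delta eps Phi x (word s)).

Lemma act_word_nil x : act_word x [::] = eps x *: (1 : walg (gl A')).
Proof. by rewrite /act_word /words_action fglift1 /= !linearZ /= fglift1. Qed.

Lemma act_word_cons x a s : act_word x (a :: s) =
  sweedler (fun y z => letter (y |> a) * act_word z s) x.
Proof.
rewrite /act_word /words_action fglift1 /= !sweedler_comp.
apply: eq_sweedler => y z; rewrite fglift1.
elim/freeg_ind: (iter_Delta _ _ _ _) => [|xs|b v w IHv IHw].
- by rewrite !linear0 mulr0.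
- by rewrite !fglift1 /= fglift1 -[X in _ * X]/(mono _) -mono_cons.
by rewrite !linearP /= IHv IHw mulrDr wscaleAr.
Qed.

Lemma act_word_linearC s : linear (act_word^~ s).
Proof.
elim: s => [|a s IHs] b x y /=.
  by rewrite !act_word_nil linearP /= scalerDl scalerA.
rewrite !act_word_cons sweedler_linear//; split=> [z|z] c u v.
  by rewrite (gl_act_linearC measPhi) linearP /= mulrDl wscaleAl.
by rewrite IHs mulrDr wscaleAr.
Qed.

Lemma letter_gl_act_linearC a : linear (fun x => letter (x |> a)).
Proof. by move=> b x y; rewrite (gl_act_linearC measPhi) linearP. Qed.

(** Alternation: by cocommutativity the sum of x_(1) a x_(2) a over x equals its
    opposite, and 2 is invertible in K. *)
Lemma act_word_compatible x : compatible ext (act_word x).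
Proof.
split=> [s1 s2 a u v|e s1 u s2].
  elim: s1 x => [|b s1 IHs] x; rewrite !act_word_cons -sweedler_lincomb.
    by apply: eq_sweedler => y z; rewrite !linearP /= mulrDl wscaleAl.
  by apply: eq_sweedler => y z; rewrite IHs mulrDr wscaleAr.
elim: s1 x => [|b s1 IHs] x; rewrite act_word_cons; last first.
  rewrite -[RHS](sweedler0 Delta _ x).
  by apply: eq_sweedler => y z; rewrite IHs mulr0.
have sq y : sweedler (fun p q => letter (p |> u) * letter (q |> u)) y = 0.
  set S := sweedler _ y; suff : S = - S.
    move/eqP; rewrite -addr_eq0 -mulr2n -scaler_nat scaler_eq0.
    have /pcharf0P-> := charK0; by move=> /orP[//|/eqP].
  rewrite {1}/S sweedlerC//; last first.
    by split=> [z|z] c p q; rewrite letter_gl_act_linearC;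
       rewrite ?(mulrDl, wscaleAl, mulrDr, wscaleAr).
  rewrite -[RHS]addr0 -scaleN1r -[X in _ + X](sweedler0 Delta _ y).
  rewrite -sweedler_lincomb; apply: eq_sweedler => p q.
  by rewrite letter_anticomm// scaleN1r addr0.
transitivity (sweedler (fun y z =>
    sweedler (fun p q => letter (p |> u) * letter (q |> u) * act_word z s2) y) x).
  rewrite (sweedlerA coalgC) => [|p q c v w|p q c v w|p q c v w]; last 3 first.
  - by rewrite act_word_linearC mulrDr wscaleAr.
  - by rewrite letter_gl_act_linearC mulrDr mulrDl wscaleAr wscaleAl.
  - by rewrite letter_gl_act_linearC !mulrDl !wscaleAl.
  apply: eq_sweedler => y z.
  rewrite act_word_cons -[LHS]/(wmul _ _) sweedler_comp.
  by apply: eq_sweedler => p q; rewrite -mulrA.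
rewrite -[RHS](sweedler0 Delta _ x); apply: eq_sweedler => y z.
transitivity (
  sweedler (fun p q => letter (p |> u) * letter (q |> u)) y * act_word z s2).
  have l : linear (fun w : walg (gl A') => w * act_word z s2).
    by move=> c v w; rewrite mulrDl wscaleAl.
  by rewrite -[RHS]/(linear_of l _) sweedler_comp.
by rewrite sq mul0r.
Qed.

Definition act x : walg (gl A) -> walg (gl A') :=
  wlift (Cfun (act_word_compatible x)).
HB.instance Definition _ x := GRing.Linear.on (act x).

Lemma act_lin x a u v : act x (a *: u + v) = a *: act x u + act x v.
Proof. exact: linearP. Qed.

Lemma act_mono x s : act x (mono s) = act_word x s. Proof. exact: wliftE. Qed.

Lemma act_linearC u : linear (act^~ u).
Proof.
move=> a x y; elim/walg_ind: u => [s|b u v IHu IHv].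
  by rewrite !act_mono act_word_linearC.
rewrite !act_lin IHu IHv !scalerDr !scalerA (mulrC b) -!addrA.
by congr (_ + _); rewrite addrCA.
Qed.

Lemma act1 x : act x 1 = eps x *: (1 : walg (gl A')).
Proof. by rewrite -mono_nil act_mono act_word_nil. Qed.

Lemma act_letterM x a u :
  act x (letter a * u) = sweedler (fun y z => letter (y |> a) * act z u) x.
Proof.
elim/walg_ind: u => [s|b u v IHu IHv].
  rewrite -mono_cons act_mono act_word_cons.
  by apply: eq_sweedler => y z; rewrite act_mono.
rewrite mulrDr wscaleAr act_lin IHu IHv -sweedler_lincomb.
by apply: eq_sweedler => y z; rewrite act_lin mulrDr wscaleAr.
Qed.

Lemma sweedler_mulr (U : lmodType K) (f : C -> C -> walg U) (w : walg U) x :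
  sweedler f x * w = sweedler (fun y z => f y z * w) x.
Proof.
have l : linear (fun v : walg U => v * w).
  by move=> c u v; rewrite mulrDl wscaleAl.
by rewrite -[LHS]/(linear_of l _) sweedler_comp.
Qed.

Lemma sweedler_mull (U : lmodType K) (f : C -> C -> walg U) (w : walg U) x :
  w * sweedler f x = sweedler (fun y z => w * f y z) x.
Proof. by rewrite -[LHS]/(wmul _ _) sweedler_comp. Qed.

(** The word algebra is again measured by C; iterating the recursion that
    defines the action needs coassociativity. *)
Lemma actM x u v : act x (u * v) = sweedler (fun y z => act y u * act z v) x.
Proof.
elim/walg_cons_ind: u x => [|a u IHu|b u1 u2 I1 I2] x.
- have l : linear (act^~ v) by apply: act_linearC.
  rewrite mul1r -[LHS]/(linear_of l x) -(sweedler_counitl coalgC).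
  by apply: eq_sweedler => y z /=; rewrite act1 wscaleAl mul1r.
- rewrite -mulrA act_letterM.
  transitivity (sweedler (fun y z =>
      sweedler (fun p q => letter (y |> a) * act p u * act q v) z) x).
    apply: eq_sweedler => y z; rewrite IHu sweedler_mull.
    by apply: eq_sweedler => p q; rewrite mulrA.
  rewrite -(sweedlerA coalgC) => [|p q c s t|p q c s t|p q c s t].
  + apply: eq_sweedler => y z; rewrite act_letterM sweedler_mulr.
    by apply: eq_sweedler.
  + by rewrite act_linearC mulrDr wscaleAr.
  + by rewrite act_linearC mulrDr mulrDl wscaleAr wscaleAl.
  + by rewrite letter_gl_act_linearC !mulrDl !wscaleAl.
rewrite mulrDl wscaleAl act_lin I1 I2 -sweedler_lincomb.
by apply: eq_sweedler => y z; rewrite act_lin mulrDl wscaleAl.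
Qed.

Lemma act_letter x a : act x (letter a) = letter (x |> a).
Proof.
have l : linear (fun x => letter (x |> a)) by apply: letter_gl_act_linearC.
rewrite -[RHS]/(linear_of l x) -(sweedler_counitr coalgC) -[letter a]mulr1.
rewrite act_letterM; apply: eq_sweedler => y z.
by rewrite act1 wscaleAr mulr1.
Qed.

Lemma sweedler_swap (U : lmodType K) (F : C -> C -> C -> U) x :
    (forall u v, linear (F u v)) -> (forall u z, linear (fun v => F u v z)) ->
    (forall v z, linear (fun u => F u v z)) ->
  sweedler (fun y z => sweedler (fun u v => F y u v) z) x =
  sweedler (fun y z => sweedler (fun u v => F u y v) z) x.
Proof.
move=> F3 F2 F1; rewrite -(sweedlerA coalgC)// -(sweedlerA coalgC)//.
by apply: eq_sweedler => y z; rewrite sweedlerC.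
Qed.

Lemma ad_act_linear g u y : linear (fun z => ad (y |> g) (act z u)).
Proof. by move=> a p q; rewrite act_linearC linearP. Qed.

Lemma ad_gl_act_linear g (u : walg (gl A')) : linear (fun y => ad (y |> g) u).
Proof. by move=> a p q; rewrite (gl_act_linearC measPhi) ad_lincomb. Qed.

(** Passing x through the letters in front of the one that is bracketed
    permutes the Sweedler factors. *)
Lemma act_ad x g u :
  act x (ad g u) = sweedler (fun y z => ad (y |> g) (act z u)) x.
Proof.
elim/walg_cons_ind: u x => [|h u IHu|b u1 u2 I1 I2] x.
- rewrite der1 linear0 -[LHS](sweedler0 Delta _ x).
  by apply: eq_sweedler => y z; rewrite act1 linearZ /= der1 scaler0.
- rewrite derM linearD /= der_letter !act_letterM /=.
  transitivity (sweedler (fun y z => sweedler (fun p q =>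
      letter (lie (y |> g) (p |> h)) * act q u) z) x +
    sweedler (fun y z => sweedler (fun p q =>
      letter (y |> h) * ad (p |> g) (act q u)) z) x).
    congr (_ + _); last first.
      by apply: eq_sweedler => y z; rewrite IHu sweedler_mull.
    rewrite -(sweedlerA coalgC) => [|p q c s t|p q c s t|p q c s t].
    + apply: eq_sweedler => y z; rewrite (gl_act_lie cC measPhi).
      by rewrite sweedler_comp sweedler_mulr.
    + by rewrite act_linearC mulrDr wscaleAr.
    + by rewrite (gl_act_linearC measPhi) !linearP /= mulrDl wscaleAl.
    + by rewrite (gl_act_linearC measPhi) lie_linearl linearP /= mulrDl wscaleAl.
  rewrite [X in _ + X]sweedler_swap => [|p q c s t|p q c s t|p q c s t].
  + rewrite -sweedlerD; apply: eq_sweedler => y z.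
    rewrite act_letterM sweedler_comp -sweedlerD; apply: eq_sweedler => p q.
    by rewrite /= derM der_letter.
  + by rewrite ad_act_linear mulrDr wscaleAr.
  + by rewrite ad_gl_act_linear mulrDr wscaleAr.
  + by rewrite letter_gl_act_linearC mulrDl wscaleAl.
rewrite der_lin act_lin I1 I2 -sweedler_lincomb.
by apply: eq_sweedler => y z; rewrite act_lin der_lin.
Qed.

Lemma act_sgn x u : act x (sgn u) = sgn (act x u).
Proof.
elim/walg_cons_ind: u x => [|a u IHu|b u v IHu IHv] x.
- by rewrite sgn1 act1 linearZ /= sgn1.
- rewrite sgnM sgn_letter mulNr [act x (- _)]linearN /= !act_letterM !sweedler_comp.
  by apply: eq_sweedler => y z; rewrite /= sgnM sgn_letter IHu mulNr.
by rewrite !(act_lin, sgn_lin) IHu IHv.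
Qed.

Lemma act_wd x u : act x (wd u) = wd (act x u).
Proof.
elim/walg_rcons_ind: u x => [|u g IHu|b u v IHu IHv] x.
- by rewrite act1 [wd (_ *: _)]linearZ /= !wd1 linear0 scaler0.
- rewrite wdM [act x (_ + _)]linearD /= !actM act_ad sweedler_comp.
  rewrite [X in _ + X]sweedlerC//; last first.
    by split=> [z|y]; [apply: ad_gl_act_linear | apply: ad_act_linear].
  rewrite -sweedlerD; apply: eq_sweedler => y z.
  by rewrite /= act_letter wdM IHu act_sgn.
by rewrite !(act_lin, wd_lin) IHu IHv.
Qed.

Lemma act_wmap (f : {linear gl A -> gl A}) (f' : {linear gl A' -> gl A'}) x u :
  (forall y a, y |> f a = f' (y |> a)) -> act x (wmap f u) = wmap f' (act x u).
Proof.
move=> ff'; elim/walg_cons_ind: u x => [|a u IHu|b u v IHu IHv] x.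
- by rewrite wmap1 !act1 linearZ /= wmap1.
- rewrite wmapM wmap_letter !act_letterM sweedler_comp.
  by apply: eq_sweedler => y z; rewrite /= wmapM wmap_letter ff' IHu.
by rewrite !(act_lin, wmap_lin) IHu IHv.
Qed.

Lemma act_wplus x u v :
  act x (wplus u v) = sweedler (fun y z => wplus (act y u) (act z v)) x.
Proof.
rewrite /wplus actM; apply: eq_sweedler => y z.
by congr (_ * _); apply: act_wmap => p a;
  rewrite /gl_act /= /inl_gl /inr_gl gl_map_oplus linear0.
Qed.

End Action.

(** * Polynomials in an endomorphism *)

Section PolynomialsInEndomorphism.
Variables (K : fieldType) (T : lmodType K) (Om : {linear T -> T}).
Implicit Types (p q : {poly K}) (t : T).

Definition polyend p t : T := \sum_(i < size p) p`_i *: iter i Om t.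

Lemma iter_linear n : linear (iter n Om).
Proof. by elim: n => [|n IHn] a u v; rewrite ?iterS ?IHn ?linearP. Qed.

Lemma polyend_is_linear p : linear (polyend p).
Proof.
move=> a u v; rewrite /polyend scaler_sumr -big_split; apply: eq_bigr => i _ /=.
by rewrite iter_linear scalerDr !scalerA mulrC.
Qed.

HB.instance Definition _ p :=
  GRing.isLinear.Build K T T _ (polyend p) (polyend_is_linear p).

Lemma polyend_widen n p t : (size p <= n)%N ->
  polyend p t = \sum_(i < n) p`_i *: iter i Om t.
Proof.
move=> pn; rewrite /polyend (big_ord_widen n (fun i => p`_i *: iter i Om t))//.
rewrite big_mkcond; apply: eq_bigr => i _; case: ltnP => // /(nth_default 0)->.
by rewrite scale0r.
Qed.

Lemma polyendD p q t : polyend (p + q) t = polyend p t + polyend q t.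
Proof.
pose n := maxn (size p) (size q).
rewrite !(@polyend_widen n) ?size_polyD ?leq_maxl ?leq_maxr// -big_split.
by apply: eq_bigr => i _; rewrite coefD scalerDl.
Qed.

Lemma polyendZ c p t : polyend (c *: p) t = c *: polyend p t.
Proof.
rewrite (polyend_widen t (size_scale_leq c p)) scaler_sumr.
by apply: eq_bigr => i _; rewrite coefZ scalerA.
Qed.

Lemma polyendC c t : polyend c%:P t = c *: t.
Proof. by rewrite (@polyend_widen 1) ?size_polyC_leq1// big_ord1 coefC. Qed.

Lemma polyendMX p t : polyend (p * 'X) t = Om (polyend p t).
Proof.
have sz : (size (p * 'X)%R <= (size p).+1)%N.
  by rewrite (leq_trans (size_polyMleq _ _))// size_polyX addn2.
rewrite (polyend_widen t sz) big_ord_recl coefMX /= scale0r add0r linear_sum.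
by apply: eq_bigr => i _; rewrite coefMX /= linearZ.
Qed.

Lemma polyend_comm p t : polyend p (Om t) = Om (polyend p t).
Proof.
rewrite linear_sum; apply: eq_bigr => i _.
by rewrite linearZ /= -iterSr.
Qed.

Lemma polyendM p q t : polyend (p * q) t = polyend p (polyend q t).
Proof.
elim/poly_ind: p => [|p c IHp]; first by rewrite mul0r /polyend size_poly0 !big_ord0.
rewrite mulrDl mulrAC mul_polyC !polyendD polyendZ !polyendMX IHp.
by rewrite polyendC.
Qed.

End PolynomialsInEndomorphism.

(** * Integral symmetric matrices *)

Section SumOfSquares.
Variable G : finType.

(** The diagonal entries are sums of squares. As K need not be ordered, the
    matrices are taken over int. *)
Lemma sum_gram_eq0 m n (P : G -> 'M[int]_(m, n)) :
  \sum_g (P g)^T *m P g = 0 -> forall g, P g = 0.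
Proof.
move=> P0 g; apply/matrixP => k j; rewrite mxE; apply/eqP.
have sq0 (x : int) : 0 <= x * x by rewrite -expr2 Num.Theory.sqr_ge0.
have : (\sum_h (P h)^T *m P h) j j = 0 by rewrite P0 mxE.
rewrite summxE => /eqP; rewrite Num.Theory.psumr_eq0 => [|h _]; last first.
  by rewrite mxE Num.Theory.sumr_ge0// => i _; rewrite mxE.
move=> /allP/(_ g (mem_index_enum g)); rewrite mxE.
rewrite Num.Theory.psumr_eq0 => [|i _]; last by rewrite mxE.
move=> /allP/(_ k (mem_index_enum k)); rewrite mxE mulf_eq0.
by case/orP.
Qed.

End SumOfSquares.

Section GramAnnihilator.
Variables (G : finType) (n : nat) (M : G -> 'M[int]_n.+1).
Let B := \sum_g (M g)^T *m M g.

Lemma gram_sym : B^T = B.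
Proof.
rewrite linear_sum; apply: eq_bigr => g _.
by rewrite /= trmx_mul trmxK.
Qed.

Lemma horner_gram_sym q : (horner_mx B q)^T = horner_mx B q.
Proof.
elim/poly_ind: q => [|q c IHq]; first by rewrite rmorph0 linear0.
rewrite rmorphD rmorphM /= horner_mx_X horner_mx_C linearD /= tr_scalar_mx.
rewrite trmx_mul IHq gram_sym; congr (_ + _).
exact: comm_mx_horner.
Qed.

(** A symmetric matrix commuting with B may lose all factors B but one: if
    B ^ (k+2) N = 0 then P = B ^ (k+1) N satisfies P^T P = 0. *)
Lemma gram_pow_mul_eq0 (N : 'M[int]_n.+1) k :
  N^T = N -> B * N = N * B -> B ^+ k * N = 0 -> B * N = 0.
Proof.
move=> Ns BN; elim: k => [|[|k] IHk]; first by rewrite expr0 mul1r => ->; rewrite mulr0.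
  by rewrite expr1.
move=> BkN; apply: IHk.
have Bks : (B ^+ k.+1)^T = B ^+ k.+1.
  elim: (k.+1) => [|i IHi]; first by rewrite expr0 tr_scalar_mx.
  rewrite exprS trmx_mul IHi gram_sym.
  exact/esym/(commrX i (erefl (B * B))).
apply: (@sum_gram_eq0 'I_1 _ _ (fun=> B ^+ k.+1 * N) _ ord0).
rewrite big_ord1 trmx_mul Bks Ns.
rewrite -[LHS]/(N * B ^+ k.+1 * (B ^+ k.+1 * N)) {1}exprSr !mulrA.
by rewrite -(mulrA (N * B ^+ k) B) -exprS -mulrA BkN mulr0.
Qed.

(** Write the characteristic polynomial of B as X ^ m q with q(0) != 0. By
    Cayley-Hamilton B ^ m q(B) = 0, so B q(B) = 0 by symmetry, that is
    q(B) (sum of M g ^T M g) q(B) = 0, a sum of Gram matrices. *)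
Lemma gram_annihilator :
  exists2 q : {poly int}, q.[0] != 0 & forall g, M g *m horner_mx B q = 0.
Proof.
have [m [q]] := multiplicity_XsubC (char_poly B) 0.
have /monic_neq0-> /= := char_poly_monic B.
rewrite /root subr0 => q0 /(congr1 (horner_mx B)).
rewrite Cayley_Hamilton rmorphM rmorphXn /= horner_mx_X => /esym NB.
exists q => //; set N := horner_mx B q in NB *.
have Ns : N^T = N by apply: horner_gram_sym.
have BN : B * N = N * B by apply: comm_mx_horner.
have BN0 : B * N = 0.
  apply: (@gram_pow_mul_eq0 N m) => //.
  by rewrite -[RHS]NB; apply/esym/(commrX m (esym BN : GRing.comm N B)).
apply: (@sum_gram_eq0 G _ _ (fun g => M g *m N)).
under eq_bigr => g _ do rewrite trmx_mul !mulmxA -[_ *m _ *m M g]mulmxA.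
rewrite -mulmx_suml -mulmx_sumr Ns -/B.
by rewrite -mulmxA [B *m N]BN0 mulmx0.
Qed.

End GramAnnihilator.

Section IntegralAction.
Variables (K : fieldType) (T : lmodType K).
Hypothesis charK0 : [pchar K] =i pred0.

Lemma intr_eq0_char0 (m : int) : (m%:~R == 0 :> K) = (m == 0).
Proof.
have n0 := (pcharf0P K).1 charK0.
case: m => m; first by rewrite -pmulrn n0.
by rewrite NegzE mulrNz oppr_eq0 -pmulrn n0 oppr_eq0.
Qed.

Variables (G : finType) (inv : G -> G) (th : G -> {linear T -> T}).

(** With th the action of matrix units and inv their transposition this is the
    Casimir operator of gl_r. *)
Definition casimir t := \sum_g th g (th (inv g) t).

Lemma casimir_is_linear : linear casimir.
Proof.
move=> a u v; rewrite /casimir scaler_sumr -big_split.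
by apply: eq_bigr => g _; rewrite !linearP.
Qed.

HB.instance Definition _ := GRing.isLinear.Build K T T _ casimir casimir_is_linear.

(** Since q(0) != 0, such a t has no component in the generalized kernel of the
    Casimir operator. *)
Definition annihilated t := exists2 q : {poly K}, q.[0] != 0 & polyend casimir q t = 0.

(** Closure under sums: the product of two annihilators. *)
Lemma annihilated_lin a u v :
  annihilated u -> annihilated v -> annihilated (a *: u + v).
Proof.
move=> [p p0 pu] [q q0 qv]; exists (p * q).
  by rewrite hornerM mulf_neq0.
rewrite linearP /= [in X in a *: X]mulrC !polyendM pu qv.
by rewrite !linear0 addr0.
Qed.

Lemma annihilated0 : annihilated 0.
Proof. by exists 1; rewrite ?hornerC ?oner_neq0// linear0. Qed.

Lemma annihilated_sum (I : Type) (r : seq I) (P : pred I) (F : I -> T) :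
  (forall i, P i -> annihilated (F i)) -> annihilated (\sum_(i <- r | P i) F i).
Proof.
move=> kF; elim/big_ind: _ => //; first exact: annihilated0.
by move=> u v ku kv; rewrite -[u]scale1r; apply: annihilated_lin.
Qed.

Lemma annihilated_scale a u : annihilated u -> annihilated (a *: u).
Proof.
move=> ku; rewrite -[_ *: _]addr0.
by apply: annihilated_lin => //; apply: annihilated0.
Qed.

Section Family.
Variables (n : nat) (W : 'I_n -> T) (M : G -> 'M[int]_n).
Hypothesis thW : forall g a, th g (W a) = \sum_b (M g a b)%:~R *: W b.
Hypothesis Minv : forall g, M (inv g) = (M g)^T.

Definition comb (v : 'rV[int]_n) : T := \sum_a (v 0 a)%:~R *: W a.

Lemma th_comb g v : th g (comb v) = comb (v *m M g).
Proof.
rewrite linear_sum /=.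
under eq_bigr => a _ do rewrite linearZ /= thW scaler_sumr.
rewrite exchange_big; apply: eq_bigr => b _; rewrite mxE rmorph_sum scaler_suml.
by apply: eq_bigr => a _; rewrite scalerA rmorphM.
Qed.

Lemma comb_linear a u v : comb (a *: u + v) = a%:~R *: comb u + comb v.
Proof.
rewrite scaler_sumr -big_split; apply: eq_bigr => i _ /=.
by rewrite !mxE rmorphD rmorphM scalerDl scalerA.
Qed.

Lemma comb0 : comb 0 = 0.
Proof. by rewrite /comb big1// => a _; rewrite mxE scale0r. Qed.

Lemma casimir_comb v : casimir (comb v) = comb (v *m \sum_g (M g)^T *m M g).
Proof.
rewrite /casimir mulmx_sumr.
transitivity (\sum_g comb (v *m ((M g)^T *m M g))).
  by apply: eq_bigr => g _; rewrite !th_comb Minv mulmxA.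
rewrite (@big_morph _ _ comb 0 +%R 0 +%R)//; last exact: comb0.
by move=> u w; rewrite -[u]scale1r comb_linear !scale1r.
Qed.

End Family.

(** On the span of W the Casimir operator is the Gram matrix of the M g, whose
    entries are integers; the annihilator found over int is mapped to K. *)
Lemma family_annihilated n (W : 'I_n -> T) (M : G -> 'M[int]_n) :
    (forall g a, th g (W a) = \sum_b (M g a b)%:~R *: W b) ->
    (forall g, M (inv g) = (M g)^T) ->
  forall g a, annihilated (th g (W a)).
Proof.
case: n W M => [|n] W M thW Minv g a; first by case: a.
have [q q0 Mq] := gram_annihilator M; set B := \sum_g _ in Mq.
exists (map_poly intr q).
  by rewrite -(rmorph0 (intr : int -> K)) horner_map intr_eq0_char0.
have polyend_comb v :
    polyend casimir (map_poly intr q) (comb W v) = comb W (v *m horner_mx B q).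
  elim/poly_ind: {q0 Mq} q v => [|q c IHq] v.
    by rewrite !rmorph0 mulmx0 comb0 /polyend size_poly0 big_ord0.
  rewrite !rmorphD !rmorphM /= map_polyX map_polyC horner_mx_X horner_mx_C.
  rewrite polyendD polyendMX polyendC -polyend_comm /= (casimir_comb thW Minv) -/B IHq.
  rewrite mulmxDr mul_mx_scalar [in RHS]addrC comb_linear addrC; congr (_ + _).
  rewrite -mulmxA; congr (comb _ (_ *m _)).
  exact: comm_mx_horner.
have -> : th g (W a) = comb W (row a (M g)).
  by rewrite thW; apply: eq_bigr => b _; rewrite mxE.
by rewrite polyend_comb -row_mul Mq row0 comb0.
Qed.

Lemma fin_family_annihilated (I : finType) (W : I -> T) (X : G -> I -> I -> int) :
    (forall g i, th g (W i) = \sum_j (X g i j)%:~R *: W j) ->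
    (forall g i j, X (inv g) i j = X g j i) ->
  forall g i, annihilated (th g (W i)).
Proof.
move=> thW Xinv g i; rewrite -[i]enum_rankK.
apply: (@family_annihilated #|I| (fun a => W (enum_val a))
  (fun g => \matrix_(a, b) X g (enum_val a) (enum_val b))) => {g i}[g a|g].
  rewrite thW (reindex (fun a : 'I_#|I| => enum_val a)) /=; last first.
    exact/onW_bij/enum_val_bij.
  by apply: eq_bigr => b _; rewrite mxE.
by apply/matrixP => a b; rewrite !mxE Xinv.
Qed.

End IntegralAction.

(** * Coinvariants *)

Section Coinvariants.
Variables (K : fieldType) (ext : bool) (A : unitalAlgType K).
Hypothesis charK0 : [pchar K] =i pred0.
Local Notation walg := (walg ext (gl A)).
Local Notation mono := (mono ext).
Local Notation letter := (letter ext).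
Local Notation ad g := (der (ext := ext) (lie g)).

Section Bounded.
Variable r : nat.
Local Notation G := ('I_r * 'I_r)%type.

Definition unit_ad (p : G) : walg -> walg :=
  ad (gl_scalar A (elem p.1 p.2 1)).
HB.instance Definition _ p := GRing.Linear.on (unit_ad p).

Definition swap_pair (p : G) : G := (p.2, p.1).

Local Notation Om := (casimir swap_pair unit_ad).
Local Notation annihilated := (annihilated swap_pair unit_ad).

(** The coefficient of the matrix unit q in the bracket of the units g and p. *)
Definition adcoef (g p q : G) : int :=
  (g.2 == p.1)%:Z * (q == (g.1, p.2))%:Z - (p.2 == g.1)%:Z * (q == (p.1, g.2))%:Z.

(** The adjoint actions of transposed matrix units have transposed matrices:
    the fact that makes the Casimir operator a sum of Gram matrices. *)
Lemma adcoef_swap (g p q : G) : adcoef (swap_pair g) p q = adcoef g q p.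
Proof.
case: g p q => [i j] [k l] [k' l']; rewrite /adcoef /swap_pair /= !xpair_eqE.
rewrite (eq_sym k k') (eq_sym l l') (eq_sym k i) (eq_sym j k').
by congr (_ - _); [case: (i == k); case: (k' == j)
  | case: (l == j); case: (k' == k); case: (l' == i)].
Qed.

Lemma lie_elem_sum (g p : G) (x : A) :
  lie (gl_scalar A (elem g.1 g.2 1)) (elem p.1 p.2 x) =
  \sum_(q : G) (adcoef g p q)%:~R *: elem q.1 q.2 x :> gl A.
Proof.
have pick (b : bool) (q0 : G) :
    \sum_(q : G) (b%:Z * (q == q0)%:Z)%:~R *: elem q.1 q.2 x =
    (b : nat)%:R *: elem q0.1 q0.2 x :> gl A.
  rewrite (bigD1 q0)//= eqxx mulr1 big1 ?addr0 // => q /negPf->.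
  by rewrite mulr0 scale0r.
rewrite lie_elem /adcoef.
under eq_bigr => q _ do rewrite rmorphB scalerBl.
by rewrite sumrB !pick.
Qed.

Definition elem_word (l : seq (G * A)) : seq (gl A) :=
  [seq elem (fst p.1 : 'I_r) (snd p.1 : 'I_r) p.2 | p <- l].

(** For a fixed list of coefficients in A, the words in the corresponding
    multiples of matrix units form a finite family, whose span the ad e_ij preserve
    with integral coefficients; it is built by adding one letter at a time. *)
Lemma elem_word_annihilated (l : seq (G * A)) g :
  annihilated (unit_ad g (mono (elem_word l))).
Proof.
(* X g i j is the coefficient of W j in ad g (W i) *)
suff [I [W [X [thW Xinv [i <-]]]]] : exists (I : finType) (W : I -> walg)
    (X : G -> I -> I -> int), [/\
      forall g i, unit_ad g (W i) = \sum_j (X g i j)%:~R *: W j,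
      forall g i j, X (swap_pair g) i j = X g j i &
      exists i, W i = mono (elem_word l)].
  exact: (fin_family_annihilated charK0 thW Xinv).
elim: l => [|[p0 x] l [I [W [X [thW Xinv [i0 Wi0]]]]]].
  exists unit, (fun=> 1), (fun _ _ _ => 0); split; [|by []|by exists tt].
  move=> h i; rewrite [LHS]der1 big1// => j _; by rewrite scale0r.
exists (G * I)%type, (fun q : G * I =>
  letter (elem (fst q.1 : 'I_r) (snd q.1 : 'I_r) x) * W q.2).
exists (fun g (q q' : G * I) => adcoef g q.1 q'.1 * (q.2 == q'.2)%:Z +
                      (q.1 == q'.1)%:Z * X g q.2 q'.2).
split.
- move=> g' [p i] /=; rewrite {1}/unit_ad derM der_letter /= -/(unit_ad g' _) thW.
  rewrite lie_elem_sum linear_sum mulr_suml mulr_sumr.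
  rewrite -(pair_big predT predT (fun q j => (adcoef g' p q * (i == j)%:Z +
    (p == q)%:Z * X g' i j)%:~R *: (letter (elem q.1 q.2 x) * W j))) /=.
  under [RHS]eq_bigr => q _.
    under eq_bigr => j _ do rewrite rmorphD scalerDl.
    rewrite big_split /=; over.
  rewrite big_split /=; congr (_ + _).
    apply: eq_bigr => q _; rewrite (bigD1 i)//= eqxx mulr1 big1 ?addr0.
      by rewrite linearZ /= wscaleAl.
    by move=> j /negPf; rewrite eq_sym => ->; rewrite mulr0 scale0r.
  rewrite (bigD1 p)//= [X in _ + X]big1 ?addr0; last first.
    move=> q /negPf; rewrite eq_sym => ->.
    by rewrite big1// => j _; rewrite mul0r scale0r.
  by apply: eq_bigr => j _; rewrite eqxx mul1r wscaleAr.
- move=> g' [p i] [q j] /=; rewrite adcoef_swap Xinv.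
  by rewrite (eq_sym i) (eq_sym p).
by exists (p0, i0); rewrite /= Wi0 mono_cons.
Qed.

(** Multilinearity reduces to matrix units, one letter after the other. *)
Lemma ad_word_annihilated (g : gl K^o) (s : seq (gl A)) :
    bounded_by r g -> (forall a, a \in s -> bounded_by r a) ->
  annihilated (ad (gl_scalar A g) (mono s)).
Proof.
move=> gr sr.
have lin_g (v : walg) : (forall p, annihilated (unit_ad p v)) ->
    annihilated (ad (gl_scalar A g) v).
  move=> kv; rewrite (elem_sum gr).
  have l : linear (fun h : gl K^o => ad (gl_scalar A h) v).
    by move=> a h h'; rewrite /gl_scalar linearP /= ad_lincomb.
  rewrite -[ad _ v]/(linear_of l _) linear_sum; apply: annihilated_sum => i _.
  rewrite linear_sum; apply: annihilated_sum => j _.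
  have -> : elem i j (g i j) = (g i j : K) *: elem i j (1 : K^o).
    by rewrite -linearZ /= [_ *: 1]mulr1.
  by rewrite linearZ; apply/annihilated_scale/(kv (i, j)).
apply: lin_g => p.
rewrite -[s]/(elem_word [::] ++ s).
elim: s [::] sr => [|a s IHs] l sr.
  by rewrite cats0; apply: elem_word_annihilated.
rewrite mono_cat mono_cons (elem_sum (sr a (mem_head _ _))).
rewrite linear_sum mulr_suml mulr_sumr linear_sum.
apply: annihilated_sum => i _.
rewrite linear_sum mulr_suml mulr_sumr linear_sum.
apply: annihilated_sum => j _.
have := IHs (rcons l ((i, j), a i j)); rewrite /elem_word map_rcons cat_rcons.
rewrite mono_cat mono_cons; apply.
by move=> b bs; apply: sr; rewrite inE bs orbT.
Qed.

Lemma unit_ad_cycle p (u : walg) : wd u = 0 -> wd (unit_ad p u) = 0.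
Proof. by move=> du; rewrite wd_ad du linear0. Qed.

Lemma ad_boundary g (u : walg) : wd u = 0 -> exists w, ad g u = wd w.
Proof.
move=> du; exists (sgn u * letter g).
by rewrite wd_homotopy du linear0 mul0r oppr0 add0r.
Qed.

(** Up to boundaries the Casimir operator is 0 on cycles, so q(0) u is
    homologous to q applied to u, which is 0. *)
Lemma annihilated_boundary (u : walg) : wd u = 0 -> annihilated u -> exists w, u = wd w.
Proof.
move=> du [q q0 qu].
have cyc v : wd v = 0 -> wd (Om v) = 0.
  by move=> dv; rewrite linear_sum big1// => p _; do 2!apply: unit_ad_cycle.
have bnd v : wd v = 0 -> exists w, Om v = wd w.
  move=> dv; rewrite /casimir; elim/big_ind: _.
  - by exists 0; rewrite [wd 0]linear0.
  - by move=> _ _ [w1 ->] [w2 ->]; exists (w1 + w2); rewrite [wd (_ + _)]linearD.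
  - by move=> p _; apply: ad_boundary; apply: unit_ad_cycle.
have cyc_polyend p : wd (polyend Om p u) = 0.
  rewrite linear_sum big1// => i _; rewrite linearZ /=.
  suff -> : wd (iter i Om u) = 0 by rewrite scaler0.
  by elim: (i : nat) => //= n; apply: cyc.
elim/poly_ind: q q0 qu => [|q c _]; first by rewrite horner0 eqxx.
rewrite hornerMXaddC mulr0 add0r => c0.
rewrite polyendD polyendMX polyendC => /eqP; rewrite addrC addr_eq0 => /eqP cu.
have [w wE] := bnd _ (cyc_polyend q).
exists (- (c^-1 *: w)); rewrite linearN linearZ /= -wE.
by rewrite -scalerN -cu scalerA mulVf// scale1r.
Qed.

End Bounded.

(** A bound r on g and on all letters of u suffices. It is asserted for all larger
    sizes so that the summands of a sum can be given a common one. *)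
Lemma annihilated_eventually (g : gl K^o) (u : walg) :
  exists r, forall r', (r <= r')%N ->
    annihilated (@swap_pair r') (@unit_ad r') (ad (gl_scalar A g) u).
Proof.
elim/walg_ind: u => [s|a u v [m mu] [n nv]]; last first.
  exists (maxn m n) => r; rewrite geq_max => /andP[mr nr].
  by rewrite linearP; apply: annihilated_lin; [apply: mu|apply: nv].
have [m gm] := gl_bounded g.
have [n sn] : exists n, forall a, a \in s -> bounded_by n a.
  elim: s => [|a s [n sn]]; first by exists 0%N.
  have [k ak] := gl_bounded a; exists (maxn k n) => b; rewrite inE.
  case/orP=> [/eqP->|/sn].
    by apply: bounded_byW ak; rewrite leq_maxl.
  by apply: bounded_byW; rewrite leq_maxr.
exists (maxn m n) => r; rewrite geq_max => /andP[mr nr].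
apply: ad_word_annihilated; first exact: bounded_byW gm.
by move=> a /sn; apply: bounded_byW.
Qed.

(** In place of splitting off the coinvariants by complete reducibility; the
    chain w need not lie in the span itself. *)
Lemma span_ad_boundary (S : set walg) (u : walg) :
    (forall v, S v -> exists (g : gl K^o) c, v = ad (gl_scalar A g) c) ->
  span S u -> wd u = 0 -> exists w, u = wd w.
Proof.
move=> SP [s sS ->].
suff [r kr] : exists r, forall r', (r <= r')%N ->
    annihilated (@swap_pair r') (@unit_ad r') (\sum_(p <- s) p.1 *: p.2).
  by move=> du; apply: annihilated_boundary (kr r (leqnn _)).
elim: s sS => [|p s IHs] sS.
  by exists 0%N => r _; rewrite big_nil; apply: annihilated0.
have [|m ms] := IHs; first by move=> q qs; apply: sS; rewrite inE qs orbT.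
have [g [c pE]] := SP _ (sS p (mem_head _ _)).
have [n kn] := annihilated_eventually g c.
exists (maxn m n) => r; rewrite geq_max => /andP[mr nr].
by rewrite big_cons pE; apply: annihilated_lin; [apply: kn|apply: ms].
Qed.

End Coinvariants.

(** * Homology *)

Section Homology.
Variables (K : fieldType) (V : lmodType K) (d : V -> V).
Hypothesis dlin : linear d.
Local Notation hclass := (hclass d).

Lemma cyclesP v : (v \in in_span [set v | d v = 0]%classic) = `[< d v = 0 >].
Proof.
apply/asboolP/asboolP; rewrite span_id//.
- by move: (linear0 (linear_of dlin)).
- by move=> a u w /= du dw; rewrite dlin du dw scaler0 addr0.
- by move: (linear0 (linear_of dlin)).
- by move=> a u w /= du dw; rewrite dlin du dw scaler0 addr0.
Qed.

Lemma val_cycle v : d v = 0 -> val (insubd 0 v : cycles d) = v.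
Proof. by move=> dv; rewrite insubdK// [_ \in _]cyclesP; apply/asboolP. Qed.

Lemma cycle_val (z : cycles d) : d (val z) = 0.
Proof. by have := valP z; rewrite cyclesP => /asboolP. Qed.

Lemma hclass_eq u v : d u = 0 -> d v = 0 ->
  hclass u = hclass v <-> exists w, u - v = d w.
Proof.
move=> du dv; have E : val (insubd 0 u - insubd 0 v : cycles d) = u - v.
  by rewrite (linearB (val : {linear cycles d -> V})) /= !val_cycle.
rewrite clP span_id.
- by split=> -[w wE]; exists w; [rewrite -E|apply: etrans E wE].
- by exists 0; rewrite [RHS](linear0 (linear_of dlin)).
- move=> a z1 z2 [w1 E1] [w2 E2]; exists (a *: w1 + w2).
  by rewrite dlin linearP /= E1 E2.
Qed.

Lemma hrep_cycle (h : homology d) : d (hrep h) = 0.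
Proof. exact: cycle_val. Qed.

Lemma hrepK (h : homology d) : hclass (hrep h) = h.
Proof. by rewrite /Defs.hclass /hrep valKd repK. Qed.

Lemma hrep_hclass v : d v = 0 -> exists w, hrep (hclass v) - v = d w.
Proof.
move=> dv; apply/hclass_eq => //; first exact: hrep_cycle.
exact: hrepK.
Qed.

Lemma hclass_lin a u v : d u = 0 -> d v = 0 ->
  hclass (a *: u + v) = a *: hclass u + hclass v.
Proof.
move=> du dv; rewrite /Defs.hclass.
have -> : insubd 0 (a *: u + v) = a *: insubd 0 u + insubd 0 v :> cycles d.
  apply: val_inj; rewrite linearP /= !val_cycle//.
  by rewrite dlin du dv scaler0 addr0.
by rewrite linearP.
Qed.

(** hclass is linear on cycles only; the sum is computed in the space of
    cycles. *)
Lemma sweedler_hclass (C : lmodType K) (Delta : {linear C -> tensor C C})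
    (f : C -> C -> V) x : (forall y z, d (f y z) = 0) ->
  hclass (sweedler Delta f x) = sweedler Delta (fun y z => hclass (f y z)) x.
Proof.
move=> df; pose F y z : cycles d := insubd 0 (f y z).
have -> : sweedler Delta f x = val (sweedler Delta F x).
  rewrite -[RHS]/((val : {linear cycles d -> V}) _) sweedler_comp.
  by apply: eq_sweedler => y z; rewrite /= val_cycle.
by rewrite /Defs.hclass valKd sweedler_comp.
Qed.

End Homology.

Lemma homology_map_hclass (K : fieldType) (V W : lmodType K) (d : V -> V)
    (d' : W -> W) (f : {linear V -> W}) v :
    linear d -> linear d' -> (forall u, f (d u) = d' (f u)) -> d v = 0 ->
  homology_map d' f (hclass d v) = hclass d' (f v).
Proof.
move=> dl dl' fd dv; have [w hw] := hrep_hclass dl dv.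
have f0 u : d u = 0 -> d' (f u) = 0 by move=> du; rewrite -fd du linear0.
apply/(hclass_eq dl') => //; try by apply: f0; rewrite ?hrep_cycle.
by exists (f w); rewrite -linearB hw fd.
Qed.

(** * The two homology theories *)

(** Only the class of dw (word s) in the word algebra matters, and it is d_word in
    both theories. *)
Section Theory.
Variables (K : fieldType) (ext : bool).
Hypothesis charK0 : [pchar K] =i pred0.
Variable dw : forall A : unitalAlgType K, words (gl A) -> words (gl A).
Hypothesis dw_linear : forall A : unitalAlgType K, linear (@dw A).
Hypothesis dwE : forall (A : unitalAlgType K) (s : seq (gl A)),
  cl (wrel ext (gl A)) (dw (word s)) = d_word ext s.
Local Notation ad g := (der (ext := ext) (lie g)).
Local Notation rel := (fun V : lmodType K => wrel ext V).

Section OneAlgebra.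
Variable A : unitalAlgType K.
Local Notation walg := (walg ext (gl A)).
Local Notation adrel := (@adjoint_rel K rel A).
Local Notation coinv := (@coinvariants K rel A).
Local Notation dch := (@chains_d K rel dw A).
Local Notation dco := (@coinvariants_d K rel dw A).
Local Notation pi := (cl adrel : walg -> coinv).
Local Notation to_coinv := (@to_coinv K rel dw A).
Local Notation hcl := (hclass dch).
Implicit Types u v w : walg.

Lemma chains_dE u : dch u = wd u.
Proof.
apply: (quot_map_wlift (f := linear_of (@dw_linear A))
  (c := Cfun (@d_word_compatible K ext A))) => s.
exact: dwE.
Qed.

Lemma chains_d_linear : linear dch.
Proof. by move=> a u v; rewrite !chains_dE linearP. Qed.

Lemma adjointE (g : gl A) u : quot_map (adjoint g) u = ad g u.
Proof.
apply: (quot_map_wlift (f := fglift _)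
  (c := Cfun (@der_word_compatible K ext _ (lie g)))) => s.
rewrite /= fglift1 linear_sum; exact: eq_bigr.
Qed.

Lemma adrelP u : adrel u -> exists (g : gl K^o) (c : walg), u = ad (gl_scalar A g) c.
Proof. by move=> [g [c ->]]; exists g, c; rewrite adjointE. Qed.

Lemma adrel_ad (g : gl K^o) u : adrel (ad (gl_scalar A g) u).
Proof. by exists g, u; rewrite adjointE. Qed.

Lemma coinvariants_dE u : dco (pi u) = pi (wd u).
Proof.
have -> : dco = quot_map (@wd K ext A).
  by rewrite /coinvariants_d; congr quot_map; apply/funext => v; apply: chains_dE.
apply: quot_mapE => s /adrelP[g [c ->]].
by rewrite /= wd_ad; apply/sub_span/adrel_ad.
Qed.

Lemma coinvariants_d_linear : linear dco.
Proof.
move=> a u v; rewrite -[u]repK -[v]repK -[X in dco X]linearP.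
by rewrite !coinvariants_dE wd_lin linearP.
Qed.

Lemma to_coinv_hclass u : wd u = 0 -> to_coinv (hcl u) = hclass dco (pi u).
Proof.
move=> du; apply: (homology_map_hclass (f := cl adrel)).
- exact: chains_d_linear.
- exact: coinvariants_d_linear.
- by move=> v; rewrite chains_dE coinvariants_dE.
- by rewrite chains_dE.
Qed.

Lemma hclass_surj (h : homology dch) : exists2 u, wd u = 0 & h = hcl u.
Proof.
exists (hrep h); last by rewrite hrepK.
by rewrite -chains_dE hrep_cycle//; apply: chains_d_linear.
Qed.

Lemma hcl_eq u v : wd u = 0 -> wd v = 0 -> hcl u = hcl v <-> exists w, u - v = wd w.
Proof.
move=> du dv; rewrite hclass_eq ?chains_dE//; last exact: chains_d_linear.
by split=> -[w E]; exists w; rewrite ?chains_dE// E chains_dE.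
Qed.

(** The transported product is meaningful because of this injectivity. If u - v
    becomes the boundary of the class of w, then u - v - d w is a cycle in the
    span of the translates under gl K. *)
Lemma to_coinv_inj : injective to_coinv.
Proof.
move=> h1 h2; have [u du ->] := hclass_surj h1; have [v dv ->] := hclass_surj h2.
rewrite !to_coinv_hclass//; have dpi w : wd w = 0 -> dco (pi w) = 0.
  by move=> dw0; rewrite coinvariants_dE dw0 linear0.
move=> /(hclass_eq coinvariants_d_linear (dpi _ du) (dpi _ dv))[w].
rewrite -[w]repK coinvariants_dE => E; apply/hcl_eq => //.
have : pi (u - v - wd (rep w)) = 0.
  have piB (t t' : walg) : pi (t - t') = pi t - pi t' by exact: linearB.
  by rewrite !piB E subrr.
move=> /cl_eq0 Sp; have [|w' E'] := span_ad_boundary charK0 adrelP Sp.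
  have wdB (t t' : walg) : wd (t - t') = wd t - wd t' by exact: linearB.
  by rewrite !wdB du dv wd_wd !subr0.
by exists (w' + rep w); rewrite [wd _]linearD /= -E' subrK.
Qed.

Lemma coinv_mulE u v : coinv_mul (pi u) (pi v) = pi (wplus u v).
Proof.
rewrite /coinv_mul cl_oplus_words !repK.
have l w : linear (fun t => pi (wplus t w)).
  by move=> a s t; rewrite wplus_linearl linearP.
transitivity (pi (wplus u (rep (pi v)))).
  apply: (rep_cl (f := linear_of (l (rep (pi v))))) => s /adrelP[g [c ->]] /=.
  by rewrite wplus_adl -gl_scalar_inl; apply/cl_eq0/sub_span/adrel_ad.
have l' : linear (fun t => pi (wplus u t)).
  by move=> a s t; rewrite wplus_linearr linearP.
apply: (rep_cl (f := linear_of l')) => s /adrelP[g [c ->]] /=.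
by rewrite wplus_adr -gl_scalar_inr; apply/cl_eq0/sub_span/adrel_ad.
Qed.

Lemma wplus_cycle u v : wd u = 0 -> wd v = 0 -> wd (wplus u v) = 0.
Proof.
by move=> du dv; rewrite wd_wplus du dv !linear0 /wplus linear0 mul0r addr0.
Qed.

Lemma wplus_boundary u v w1 w2 : wd u = 0 -> wd v = 0 ->
  exists w, wplus (u + wd w1) (v + wd w2) - wplus u v = wd w.
Proof.
move=> du dv; exists (wplus w1 (v + wd w2) + wplus (sgn u) w2).
have dv2 : wd (v + wd w2) = 0 by rewrite linearD /= dv wd_wd addr0.
have plus0 w : wplus 0 w = 0 :> walg by rewrite /wplus linear0 mul0r.
have plusD t s w : wplus (t + s) w = wplus t w + wplus s w :> walg.
  by rewrite /wplus linearD mulrDl.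
rewrite [RHS]linearD /= !wd_wplus dv2 wd_sgn du sgnK [sgn 0]linear0 oppr0 plus0.
rewrite [wplus _ 0]linear0 add0r addr0 plusD [wplus u (_ + _)]linearD /=.
by rewrite [LHS]addrC !addrA addNr add0r addrC.
Qed.

Lemma Hcoinv_mulE u v : wd u = 0 -> wd v = 0 ->
  @Hcoinv_mul K rel dw A (hclass dco (pi u)) (hclass dco (pi v)) =
  hclass dco (pi (wplus u v)).
Proof.
move=> du dv; have dpi w : wd w = 0 -> dco (pi w) = 0.
  by move=> dw0; rewrite coinvariants_dE dw0 linear0.
rewrite /Hcoinv_mul.
have hrepE w : wd w = 0 -> exists w', hrep (hclass dco (pi w)) = pi (w + wd w').
  move=> dw0; have [t E] := hrep_hclass coinvariants_d_linear (dpi _ dw0).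
  exists (rep t); rewrite linearD /= -coinvariants_dE repK -E.
  by rewrite addrC subrK.
have [w1 ->] := hrepE u du; have [w2 ->] := hrepE v dv.
rewrite coinv_mulE; apply/(hclass_eq coinvariants_d_linear).
- by rewrite dpi// wplus_cycle// linearD /= ?du ?dv wd_wd addr0.
- by rewrite dpi// wplus_cycle.
have [w E] := wplus_boundary w1 w2 du dv.
exists (pi w); rewrite coinvariants_dE -E.
by symmetry; apply: (linearB (cl adrel)).
Qed.

(** The class of wplus u v is one preimage of the product of coinvariants, hence
    the only one. *)
Lemma Hgl_mulE u v : wd u = 0 -> wd v = 0 ->
  @Hgl_mul K rel dw A (hcl u) (hcl v) = hcl (wplus u v).
Proof.
move=> du dv; apply: to_coinv_inj.
have : exists z, to_coinv z =
    @Hcoinv_mul K rel dw A (to_coinv (hcl u)) (to_coinv (hcl v)).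
  exists (hcl (wplus u v)).
  by rewrite !to_coinv_hclass ?wplus_cycle// Hcoinv_mulE.
move=> /xgetPex -/(_ 0) /= ->.
by rewrite !to_coinv_hclass ?wplus_cycle// Hcoinv_mulE.
Qed.

End OneAlgebra.

Section Measuring.
Variable C : lmodType K.
Variables (Delta : {linear C -> tensor C C}) (eps : {linear C -> K^o}).
Hypotheses (coalgC : is_coalgebra Delta eps) (cC : cocommutative Delta).
Variables (A A' : unitalAlgType K) (Phi : C -> {linear A -> A'}).
Hypothesis measPhi : measuring Delta eps amul aone amul aone (fun x => Phi x).
Local Notation act := (act charK0 coalgC cC measPhi (ext := ext)).
Local Notation hact := (@Hgl_action K rel dw C Delta eps A A' Phi).
Local Notation hcl A := (hclass (@chains_d K rel dw A)).

Lemma hactE x u : wd u = 0 -> hact x (hcl A u) = hcl A' (act x u).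
Proof.
move=> du; rewrite /Hgl_action.
have -> : quot_map (words_action Delta eps Phi x) = act x.
  rewrite /words_action; apply/funext => v.
  apply: (quot_map_wlift (f := fglift _)
    (c := Cfun (act_word_compatible ext charK0 coalgC cC measPhi x))) => s.
  by [].
apply: homology_map_hclass.
- exact: chains_d_linear.
- exact: chains_d_linear.
- by move=> v; rewrite !chains_dE /= act_wd.
- by rewrite chains_dE.
Qed.

Lemma act_cycle x u : wd u = 0 -> wd (act x u) = 0.
Proof. by move=> du; rewrite -act_wd du linear0. Qed.

Lemma Hgl_measuring : measuring Delta eps
  (@Hgl_mul K rel dw A) (@Hgl_one K rel dw A)
  (@Hgl_mul K rel dw A') (@Hgl_one K rel dw A') hact.
Proof.
have dlA := @chains_d_linear A; have dlA' := @chains_d_linear A'.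
have one_cycle (B : unitalAlgType K) : wd (1 : walg ext (gl B)) = 0 by apply: wd1.
split.
- move=> x a h1 h2.
  have [u du ->] := hclass_surj h1; have [v dv ->] := hclass_surj h2.
  rewrite -hclass_lin ?chains_dE// !hactE//; last first.
    by rewrite wd_lin du dv scaler0 addr0.
  by rewrite act_lin hclass_lin// chains_dE act_cycle.
- move=> h a x y; have [u du ->] := hclass_surj h; rewrite !hactE//.
  by rewrite act_linearC hclass_lin// chains_dE act_cycle.
- move=> x h1 h2.
  have [u du ->] := hclass_surj h1; have [v dv ->] := hclass_surj h2.
  rewrite Hgl_mulE// hactE ?wplus_cycle// act_wplus sweedler_hclass//.
    by apply: eq_sweedler => y z; rewrite !hactE// Hgl_mulE// act_cycle.
  by move=> y z; rewrite chains_dE wplus_cycle// act_cycle.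
move=> x; transitivity (hcl A' (act x 1)); first exact: (hactE x (one_cycle A)).
rewrite act1.
(* additivity of hclass is only known on cycles, so scaling goes through 0 *)
have d0 : @chains_d K rel dw A' 0 = 0 by rewrite chains_dE linear0.
have h0 : hcl A' 0 = 0.
  have := hclass_lin dlA' (-1) d0 d0.
  by rewrite scaler0 addr0 scaleN1r addNr.
have := hclass_lin dlA' (eps x) (_ : @chains_d K rel dw A' (mono ext [::]) = 0) d0.
by rewrite h0 !addr0 chains_dE one_cycle => ->.
Qed.

End Measuring.
End Theory.

Theorem theorem1p5 (K : fieldType) (charK0 : [pchar K] =i pred0)
    (A A' : unitalAlgType K)
    (C : lmodType K) (Delta : {linear C -> tensor C C})
    (eps : {linear C -> K^o})
    (coalgC : is_coalgebra Delta eps) (cocommC : cocommutative Delta)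
    (Phi : C -> {linear A -> A'})
    (measPhi : measuring Delta eps amul aone amul aone (fun x => Phi x)) :
  measuring Delta eps (H_mul A) (H_one A) (H_mul A') (H_one A')
    (H_map Delta eps Phi) /\
  measuring Delta eps (HL_mul A) (HL_one A) (HL_mul A') (HL_one A')
    (HL_map Delta eps Phi).
Proof.
split.
  apply: (Hgl_measuring (ext := true) charK0 (dw := @d_CE K)) => //.
  - by move=> B; apply: fglift_is_linear.
  - by move=> B s; apply: d_CE_Leibniz.
apply: (Hgl_measuring (ext := false) charK0 (dw := @d_Leibniz K)) => //.
by move=> B; apply: fglift_is_linear.
Qed.
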